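(* Let $p\in[0,1)$ and $q=2p-1\in[-1,1)$. There exists a zero-mean martingale $(\Xi_n)_{n\ge0}$ adapted to $(\mathcal F_n)_{n\ge0}$, with bounded increments and with predictable quadratic variation $\langle\Xi\rangle_n=\sum_{k=1}^n\mathbb E[(\Xi_k-\Xi_{k-1})^2\mid\mathcal F_{k-1}]$ satisfying $\langle\Xi\rangle_n/n\to1$ almost surely, such that for all $n\ge 0$ $$\Delta^{(s)}_n=\Xi_n+q\sum_{k=1}^{n-1}(-1)^k\frac{W_k}{k}.$$ Moreover the predictable process $Z_n:=\Delta^{(s)}_n-\Xi_n$ converges almost surely and in $L^2$ to the zero-mean random variable $Z_\infty:=q\sum_{k=1}^\infty(-1)^k\frac{W_k}{k}$, whose second moment is $$\mathbb E[Z_\infty^2]=\begin{cases}\dfrac{q^2}{2q-1}\displaystyle\int_0^1\frac{u^{-2q+1}-1}{1-u}\cdot\frac{(1-\frac u2)^{q-1}-1}{u}\,du & q\neq\tfrac12,\\[8pt] \dfrac14\displaystyle\int_0^1\frac{-\ln u}{1-u}\cdot\frac{(1-\frac u2)^{-1/2}-1}{u}\,du & q=\tfrac12.\end{cases}$$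
   Context: Let $D_\infty=\langle a,b\mid a^2=e,\ b^2=e\rangle$ be the infinite dihedral group (its Cayley graph with respect to $\{a,b\}$ is the bi-infinite path). Fix a memory parameter $p\in[0,1]$ and set $q=2p-1$. The elephant random walk (ERW) on $D_\infty$ has steps $g_1,g_2,\dots\in\{a,b\}$ defined as follows: $g_1$ is uniform on $\{a,b\}$; with $\mathcal F_n=\sigma(g_1,\dots,g_n)$ ($\mathcal F_0$ trivial), given $\mathcal F_n$ ($n\ge1$) pick $I_{n+1}$ uniform on $\{1,\dots,n\}$ and set $g_{n+1}=g_{I_{n+1}}$ with probability $p$ and $g_{n+1}=$ the other generator (i.e. $b$ if $g_{I_{n+1}}=a$, $a$ if $g_{I_{n+1}}=b$) with probability $1-p$. Equivalently, if $A_n,B_n$ denote the numbers of $a$-steps and $b$-steps among $g_1,\dots,g_n$, then $\mathbb P(g_{n+1}=a\mid\mathcal F_n)=\frac{pA_n+(1-p)B_n}{n}$. The position is $w_0=e$ and $w_n$ = the reduced word of $g_ng_{n-1}\cdots g_1$ (reduced using $a^2=b^2=e$); $\Delta_n$ is the length of $w_n$. The signed location is $\Delta^{(s)}_n=\Delta_n$ if $w_n=e$ or the rightmost letter of the reduced word $w_n$ is $a$, and $\Delta^{(s)}_n=-\Delta_n$ if its rightmost letter is $b$ (so $a,ba,aba,\dots$ sit at $1,2,3,\dots$ and $b,ab,bab,\dots$ at $-1,-2,-3,\dots$). Finally $W_0=0$ and $W_n=A_n-B_n$ (this is the classical elephant random walk on $\mathbb Z$). *)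

(* Defs.v *)
From HB Require Import structures.
From mathcomp Require Import all_boot all_order all_algebra.
From mathcomp Require Import all_classical all_reals all_analysis.
Set Implicit Arguments. Unset Strict Implicit. Unset Printing Implicit Defensive.
Import Order.TTheory GRing.Theory Num.Theory.
Import numFieldNormedType.Exports.
Local Open Scope classical_set_scope.
Local Open Scope ring_scope.

(* Generators: true = a, false = b. *)

Section ERW.
Variable R : realType.

Definition step_prob (p : R) (t : seq bool) (b : bool) : R :=
  match t with
  | [::] => 1 / 2
  | _ => let k := (size t)%:R in let A := (count id t)%:R in
         let pa := (p * A + (1 - p) * (k - A)) / k in
         if b then pa else 1 - pa
  end.

Definition erw_prob (p : R) (s : seq bool) : R :=
  \prod_(i < size s) step_prob p (take i s) (nth false s i).

Variable T : Type.
(* g n : the n-th step g_n (n >= 1; g 0 is unused) *)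
Variable g : nat -> T -> bool.

Definition steps (n : nat) (x : T) : seq bool := [seq g i.+1 x | i <- iota 0 n].

(* reduced word of g_n ... g_1, written left to right; head = leftmost letter *)
Definition lmul (w : seq bool) (b : bool) : seq bool :=
  match w with
  | c :: w' => if c == b then w' else b :: w
  | [::] => [:: b]
  end.
Definition word (n : nat) (x : T) : seq bool := foldl lmul [::] (steps n x).

Definition Delta (n : nat) (x : T) : nat := size (word n x).

Definition Delta_s (n : nat) (x : T) : R :=
  let w := word n x in
  if w is [::] then 0 else if last false w then (size w)%:R else - (size w)%:R.

Definition Wn (n : nat) (x : T) : R :=
  (count id (steps n x))%:R - (count negb (steps n x))%:R.
End ERW.

Section Cond.
Variables (R : realType) (d : measure_display) (T : measurableType d).
Variable P : probability T R.
Variable g : nat -> T -> bool.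

(* elementary conditional expectation of Y given F_n = sigma(g_1..g_n)
   (F_n is generated by the finite partition into atoms {steps n = s}) *)
Definition cexp (n : nat) (Y : T -> R) (x : T) : R :=
  Rintegral P setT (fun y => Y y * (steps g n y == steps g n x)%:R)
  / fine (P [set y | steps g n y = steps g n x]).

Definition predQV (Xi : nat -> T -> R) (n : nat) (x : T) : R :=
  \sum_(1 <= k < n.+1) cexp k.-1 (fun y => (Xi k y - Xi k.-1 y) ^+ 2) x.

Definition Fmeas (n : nat) (X : T -> R) : Prop :=
  exists f : seq bool -> R, forall x, X x = f (steps g n x).
End Cond.
Arguments Delta_s {R T} g n x.
Arguments Wn {R T} g n x.
Arguments erw_prob {R} p s.
Arguments step_prob {R} p t b.

(* Main.v *)
(* With X_k = 1 or -1 according to the k-th step, the signed location is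
   D_n = sum_(k <= n) (-1)^(k-1) X_k, and E[X_(n+1) | F_n] = q W_n / n; the
   martingale part of D_n has increments (-1)^n (X_(n+1) - q W_n / n), so it
   remains to study S_n = sum_(1 <= k < n) (-1)^k W_k / k.

   The second moments of W_n and D_n are O(n^(2 theta)) for some theta < 1, hence
   sum_k (|W_k| + |D_k|) / k^2 is almost surely finite. As the partial sums of
   (-1)^k W_k equal ((-1)^n W_n - D_n) / 2, summation by parts yields the almost
   sure convergence of S_n, and W_n / n tends to 0, which gives the quadratic
   variation.

   For the second moment, put phi(u) = (1 - u/2)^(q-1) - 1, let F_j be the
   integral over [0, 1] of (1 - u)^(j-1) phi(u), and rho_j = (F_j + 1/j) / 2.
   Integration by parts gives j rho_j + (j + q) rho_(j+1) = 1, which makes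
   E[S_n^2] + 2 (-1)^n rho_n E[S_n W_n] equal to sum_(j < n) E[W_j^2] F_j / j.
   The correction tends to 0, and the same identity for S_n - S_m together with
   Fatou's lemma gives convergence in L^2. By monotone convergence the limit
   is the integral of phi against the generating series of the coefficients
   y_j = E[W_j^2] / j, and their recurrence (j + 1) y_(j+1) = 1 + (j + 2q) y_j is a
   linear differential equation for that series, whose solution is the stated
   integrand. *)
Require Import Defs.
From HB Require Import structures.
From mathcomp Require Import all_boot all_order all_algebra.
From mathcomp Require Import all_classical all_reals all_analysis.
From mathcomp Require Import measurable_realfun.
From mathcomp Require Import ring lra.
Import Order.TTheory GRing.Theory Num.Theory.
Import numFieldNormedType.Exports.
Set Implicit Arguments. Unset Strict Implicit. Unset Printing Implicit Defensive.
Local Open Scope classical_set_scope.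
Local Open Scope ring_scope.

(** * Alternating sums of slowly growing sequences *)

Section Sequences.
Variable R : realType.
Implicit Types (a : nat -> R) (M : R).

(** Some partial sum lies within [e] of the supremum of all partial sums, and what follows it can
    contribute at most [e]. *)
Lemma bounded_sum_tail a M (e : R) : (forall k, 0 <= a k) ->
  (forall n, \sum_(1 <= k < n) a k <= M) -> 0 < e ->
  exists2 m, (0 < m)%N & forall n, \sum_(m <= k < n) a k <= e.
Proof.
move=> a0 aM e0; set s := fun n => \sum_(1 <= k < n) a k.
have s_sup : has_sup (range s).
  split; first by exists (s 0%N), 0%N.
  by exists M => _ [n _ <-]; exact: aM.
have [_ -[m _ <-] sm] := sup_adherent e0 s_sup.
exists (maxn m 1) => [|n]; first by rewrite leq_max orbT.
have [mn|/ltnW nm] := leqP (maxn m 1) n; last by rewrite big_geq ?ltW.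
have sn : s n <= sup (range s) by apply: sup_upper_bound => //; exists n.
have mm : s m <= s (maxn m 1).
  have [m0|m0] := posnP m; last by rewrite (maxn_idPl m0).
  by rewrite m0 /s !big_geq.
have : s n = s (maxn m 1) + \sum_(maxn m 1 <= k < n) a k.
  by rewrite /s (big_cat_nat (n := maxn m 1))//= leq_max orbT.
lra.
Qed.

(* [a_n ^ 2] is bounded by the sum of its increments, which are controlled by
   [|a_k|]; Kronecker's lemma concludes. *)
Lemma bounded_increments_cvg0 a (c : R) M : 0 <= c ->
  (forall n, `|a n.+1 - a n| <= c) ->
  (forall n, \sum_(1 <= k < n) (`|a k| / (k%:R * k.+1%:R)) <= M) ->
  a n / n%:R @[n --> \oo] --> 0.
Proof.
move=> c0 ac aM; apply/cvgrPdist_lt => e e0.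
have u0 k : 0 <= `|a k| / (k%:R * k.+1%:R) by rewrite divr_ge0.
(* This tail size makes the contribution of the terms beyond [m] at most half of [n ^ 2 * e ^ 2];
   the other half is left for [K] and the squared increments. Writing [c + 1] keeps the denominator
   positive when [c = 0]. *)
have d0 : 0 < e ^+ 2 / (4 * (c + 1)) by rewrite divr_gt0 ?exprn_gt0// mulr_gt0// ltr_wpDl.
have [m m0 hm] := bounded_sum_tail u0 aM d0.
have sq n : (0 < n)%N ->
    a n ^+ 2 <= a 1%N ^+ 2 + \sum_(1 <= k < n) (2 * c * `|a k| + c ^+ 2).
  elim: n => // -[_ _|n IH _]; first by rewrite big_geq// addr0.
  rewrite big_nat_recr//= addrA (le_trans _ (lerD (IH _) (lexx _)))//.
  have := ac n.+1; set x := a n.+1; set y := a n.+2 => h.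
  have -> : y ^+ 2 = x ^+ 2 + (2 * (x * (y - x)) + (y - x) ^+ 2) by ring.
  rewrite lerD2l lerD//.
    rewrite -mulrA ler_wpM2l// (le_trans (ler_norm _))// normrM mulrC.
    by rewrite ler_wpM2r.
  by rewrite -(real_normK (num_real (y - x))) lerXn2r// nnegrE.
set K := a 1%N ^+ 2 + 2 * c * \sum_(1 <= k < m) `|a k|.
have K0 : 0 <= K.
  by rewrite addr_ge0 ?sqr_ge0// mulr_ge0 ?mulr_ge0// sumr_ge0.
near=> n.
have n0 : (0 < n)%N by near: n; exact: nbhs_infty_gt.
have mn : (m <= n)%N by near: n; exact: nbhs_infty_ge.
have nR : 0 < n%:R :> R by rewrite ltr0n.
have nR1 : 1 <= n%:R :> R by rewrite ler1n.
have big : 2 * (K + c ^+ 2) / e ^+ 2 < n%:R by near: n; exact: nbhs_infty_gtr.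
rewrite sub0r normrN -(@ltr_pXn2r _ 2)// ?nnegrE ?(ltW e0)//.
rewrite real_normK ?num_real// expr_div_n ltr_pdivrMr ?exprn_gt0//.
apply: le_lt_trans (sq _ n0) _.
have -> : \sum_(1 <= k < n) (2 * c * `|a k| + c ^+ 2) =
    2 * c * \sum_(1 <= k < m) `|a k| + 2 * c * \sum_(m <= k < n) `|a k| + (n.-1)%:R * c ^+ 2.
  rewrite big_split /= sumr_const_nat subn1 -[_ *+ n.-1]mulr_natl -mulr_sumr.
  by rewrite (big_cat_nat (n := m))//= mulrDr.
(* For [k < n] the weight [k (k + 1)] is at most [n ^ 2]. *)
have t : \sum_(m <= k < n) `|a k| <= n%:R ^+ 2 * (e ^+ 2 / (4 * (c + 1))).
  apply: (@le_trans _ _ (n%:R ^+ 2 * \sum_(m <= k < n) (`|a k| / (k%:R * k.+1%:R)))).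
    rewrite mulr_sumr; apply: ler_sum_nat => k /andP[mk kn].
    have k0 : 0 < k%:R :> R by rewrite ltr0n (leq_trans m0).
    rewrite mulrCA ler_peMr// ler_pdivlMr ?mulr_gt0// mul1r expr2.
    by rewrite ler_pM// ler_nat// ltnW.
  by rewrite ler_wpM2l ?sqr_ge0.
have c1 : 0 < c + 1 by rewrite ltr_wpDl.
have t2 : 2 * c * \sum_(m <= k < n) `|a k| <= n%:R ^+ 2 * (e ^+ 2 / 2).
  apply: (@le_trans _ _ (2 * c * (n%:R ^+ 2 * (e ^+ 2 / (4 * (c + 1)))))).
    by rewrite ler_wpM2l ?mulr_ge0.
  have -> : n%:R ^+ 2 * (e ^+ 2 / 2) = 2 * (c + 1) * (n%:R ^+ 2 * (e ^+ 2 / (4 * (c + 1)))).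
    by field; rewrite gt_eqF.
  apply: ler_wpM2r; first by rewrite mulr_ge0 ?sqr_ge0// ltW.
  by rewrite ler_wpM2l// lerDl.
have t3 : (n.-1)%:R * c ^+ 2 <= n%:R * c ^+ 2.
  by rewrite ler_wpM2r ?sqr_ge0// ler_nat leq_pred.
have t4 : (K + c ^+ 2) * n%:R < n%:R ^+ 2 * (e ^+ 2 / 2).
  move: big; rewrite ltr_pdivrMr ?exprn_gt0// => big.
  rewrite [ltLHS]mulrC expr2 -mulrA ltr_pM2l//; lra.
have t5 : K <= K * n%:R by rewrite ler_peMr.
rewrite -/K in t5; move: t2 t3 t4 t5; rewrite /K.
set A := 2 * c * _; set B := 2 * c * _; set C := n%:R ^+ 2.
lra.
Unshelve. all: by end_near. Qed.

Section AlternatingSum.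
Variables (W D : nat -> R) (M : R).
Hypotheses (W0 : W 0%N = 0) (D0 : D 0%N = 0).
Hypothesis W_inc : forall n, `|W n.+1 - W n| <= 1.
Hypothesis D_inc : forall n, D n.+1 - D n = (-1) ^+ n * (W n.+1 - W n).
Hypothesis WD_sum : forall n,
  \sum_(1 <= k < n) ((`|W k| + `|D k|) / (k%:R * k.+1%:R)) <= M.

Lemma cvg_walk_div : W n / n%:R @[n --> \oo] --> 0.
Proof.
apply: (bounded_increments_cvg0 (c := 1) (M := M)) => // n.
apply: le_trans (WD_sum n); apply: ler_sum_nat => k _.
by rewrite ler_wpM2r ?invr_ge0 ?mulr_ge0// lerDl.
Qed.

Lemma cvg_location_div : D n / n%:R @[n --> \oo] --> 0.
Proof.
apply: (bounded_increments_cvg0 (c := 1) (M := M)) => // n.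
  by rewrite D_inc normrM normrX normrN1 expr1n mul1r.
apply: le_trans (WD_sum n); apply: ler_sum_nat => k _.
by rewrite ler_wpM2r ?invr_ge0 ?mulr_ge0// lerDr.
Qed.

(* The partial sums of [(-1)^k W_k]. *)
Let U n : R := ((-1) ^+ n * W n - D n) / 2.

(** Summation by parts with [1/k - 1/(k+1) = 1/(k (k+1))]. At [n = 0] the boundary term vanishes
    because the inverse of 0 is 0. *)
Let altsumE n : \sum_(1 <= k < n.+1) (-1) ^+ k * W k / k%:R =
  U n / n%:R + \sum_(1 <= k < n) U k / (k%:R * k.+1%:R).
Proof.
elim: n => [|n IH]; first by rewrite !big_geq// invr0 mulr0 addr0.
rewrite big_nat_recr//= IH; have [->|n0] := posnP n.
  rewrite !big_geq// /U W0 D0; have := D_inc 0; rewrite W0 D0 !subr0 expr0 mul1r.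
  by move=> ->; rewrite expr1 !mulr0 invr0 ?mulr0; lra.
rewrite [in RHS]big_nat_recr//=.
have UE : U n.+1 - U n = (-1) ^+ n.+1 * W n.+1.
  have -> : U n.+1 - U n = ((-1) ^+ n.+1 * W n.+1 - (-1) ^+ n * W n - (D n.+1 - D n)) / 2.
    by rewrite /U; lra.
  by rewrite D_inc exprS; lra.
rewrite -UE; set S := \sum_(_ <= _ < _) _.
have h : n%:R != 0 :> R by rewrite pnatr_eq0 -lt0n.
have h' : n%:R + 1 != 0 :> R by rewrite natr1 pnatr_eq0.
by rewrite -natr1; field; rewrite h h'.
Qed.

(** Since [|U k| <= |W k| + |D k|], the series in [altsumE] converges absolutely, and its boundary
    term [U n / n] tends to 0. *)
Lemma is_cvg_altsum : cvgn (fun n => \sum_(1 <= k < n) (-1) ^+ k * W k / k%:R).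
Proof.
have Unorm k : `|U k| <= `|W k| + `|D k|.
  rewrite /U normrM [`|2^-1|]ger0_norm// ler_pdivrMr//.
  rewrite (le_trans (ler_normB _ _))// normrM normrX normrN1 expr1n mul1r.
  by rewrite ler_peMr ?addr_ge0// ler1n.
have cvgU : cvgn (fun n => \sum_(1 <= k < n) U k / (k%:R * k.+1%:R)).
  (* The value 0 at index 0 turns the sum from 1 into a [series], which starts at 0. *)
  pose u k := if k == 0%N then 0 else U k / (k%:R * k.+1%:R).
  have E n : \sum_(1 <= k < n) U k / (k%:R * k.+1%:R) = series u n.
    rewrite /series /=; case: n => [|n]; first by rewrite !big_geq.
    rewrite [RHS]big_ltn// /u eqxx add0r; apply: eq_big_nat => k /andP[k0 _].
    by rewrite gtn_eqF.
  under eq_fun do rewrite E; apply: normed_cvg.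
  apply: nondecreasing_is_cvgn.
    apply/nondecreasing_seqP => n.
    change (\sum_(0 <= k < n) `|u k| <= \sum_(0 <= k < n.+1) `|u k|).
    by rewrite big_nat_recr//= lerDl.
  exists M => _ [n _ <-]; apply: le_trans (WD_sum n).
  change (\sum_(0 <= k < n) `|u k| <=
    \sum_(1 <= k < n) ((`|W k| + `|D k|) / (k%:R * k.+1%:R))).
  case: n => [|n]; first by rewrite !big_geq.
  rewrite big_ltn// /u eqxx normr0 add0r; apply: ler_sum_nat => k /andP[k0 _].
  rewrite gtn_eqF// normrM [`|_^-1|]ger0_norm ?invr_ge0 ?mulr_ge0//.
  by rewrite ler_wpM2r// invr_ge0 mulr_ge0.
have cvgU0 : U n / n%:R @[n --> \oo] --> 0.
  have -> : (fun n => U n / n%:R) =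
      (fun n => (-1) ^+ n * (W n / n%:R) / 2 - D n / n%:R / 2).
    by apply/funext => n; rewrite /U; lra.
  rewrite -[0](subr0 0) -{2}(mul0r 2^-1).
  apply: cvgB; last by apply: cvgMl; exact: cvg_location_div.
  rewrite -(mul0r 2^-1); apply: cvgMl.
  apply: norm_cvg0.
  have -> : (fun n => `|(-1) ^+ n * (W n / n%:R)|) = (fun n => `|W n / n%:R|).
    by apply/funext => n; rewrite normrM normrX normrN1 expr1n mul1r.
  by have h := cvg_norm cvg_walk_div; rewrite normr0 in h; exact: h.
have /cvg_ex[l hl] := cvgU.
apply/cvg_ex; exists (0 + l); rewrite -cvg_shiftS /=.
by under eq_fun do rewrite altsumE; apply: cvgD.
Qed.

End AlternatingSum.

End Sequences.

(** * The moments of [phi] *)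

Section UnitIntegral.
Variable R : realType.
Implicit Types (f h : R -> R) (a u : R).
Local Notation mu := (@lebesgue_measure R).

Lemma derivable_cont f u : derivable f u 1 -> {for u, continuous f}.
Proof. by move=> /derivable1_diffP/differentiable_continuous. Qed.

(** The half-line [u < 2] is where [1 - u / 2] is positive. It is open and contains [[0, 1]], so
    two-sided derivatives are available at both endpoints. *)
Lemma derivable_within01 f : (forall u, u < 2 -> derivable f u 1) ->
  {within `[0, 1], continuous f}.
Proof.
move=> df; apply: continuous_in_subspaceT => u; rewrite inE /= in_itv /= => /andP[_ u1].
by apply: derivable_cont; apply: df; apply: le_lt_trans u1 _; rewrite ltr1n.
Qed.

Lemma derivable_integrable01 f : (forall u, u < 2 -> derivable f u 1) ->
  mu.-integrable `[0, 1] (EFin \o f).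
Proof.
move=> df; apply: continuous_compact_integrable; first exact: segment_compact.
exact: derivable_within01.
Qed.

Lemma Rintegral01_derive f h : (forall u, u < 2 -> derivable f u 1) ->
  (forall u, u < 2 -> is_derive u 1 h (f u)) ->
  \int[mu]_(u in `[0, 1]) f u = h 1 - h 0.
Proof.
move=> df dh.
have dh' u : u < 2 -> derivable h u 1 by move=> /dh/@ex_derive.
rewrite /Rintegral (@continuous_FTC2 _ f h 0 1)//.
- exact: derivable_within01.
- split.
  + by move=> u; rewrite in_itv/= => /andP[_ u1]; apply: dh'; lra.
  + by apply: cvg_at_right_filter; apply: derivable_cont; apply: dh'; lra.
  + by apply: cvg_at_left_filter; apply: derivable_cont; apply: dh'; lra.
- move=> u; rewrite in_itv/= => /andP[_ u1]; rewrite derive1E.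
  have u2 : u < 2 by lra.
  by have [_ ->] := dh u u2.
Qed.

Lemma is_derive_mulC a f (u df : R) :
  is_derive u 1 f df -> is_derive u 1 (fun x => a * f x) (a * df).
Proof. by move=> d; exact: is_deriveZ. Qed.

Lemma is_derive_onem u : is_derive u (1 : R) (fun x : R => 1 - x) (- 1).
Proof.
apply: (is_derive_eq (is_deriveB (is_derive_cst (1 : R) u (1 : R)) (is_derive_id u (1 : R)))).
by rewrite sub0r.
Qed.

Lemma is_derive_onemX n u :
  is_derive u 1 (fun x : R => (1 - x) ^+ n) (- n%:R * (1 - u) ^+ n.-1).
Proof.
have -> : (fun x : R => (1 - x) ^+ n) = (fun x : R => 1 - x) ^+ n.
  by apply/funext => x; rewrite exprfctE.
apply: (is_derive_eq (is_deriveX n (is_derive_onem u))).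
by rewrite /GRing.scale /=; ring.
Qed.

Lemma is_derive_half_powR a u : u < 2 ->
  is_derive u 1 (fun x : R => (1 - x / 2) `^ a) (- a / 2 * (1 - u / 2) `^ (a - 1)).
Proof.
move=> u2.
have d : is_derive u (1 : R) (fun x : R => 1 - x / 2) (- 2^-1).
  have d2 : is_derive u (1 : R) (fun x : R => x / 2) (2^-1).
    have := is_deriveM (is_derive_id u (1:R)) (is_derive_cst (2^-1 : R) u (1 : R)).
    move=> /is_derive_eq; apply; rewrite /GRing.scale /=; ring.
  by apply: (is_derive_eq (is_deriveB (is_derive_cst (1 : R) u (1 : R)) d2)); rewrite sub0r.
have u0 : 0 < 1 - u / 2 by lra.
have := @is_derive1_comp _ (fun y : R => y `^ a) (fun x : R => 1 - x / 2) u _ _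
  (is_derive1_powR a u0) d.
by move=> /is_derive_eq; apply; ring.
Qed.

End UnitIntegral.

Section Moments.
Variables (R : realType) (q : R).
Hypotheses (q_ge : -1 <= q) (q_lt : q < 1).
Local Notation mu := (@lebesgue_measure R).

Definition phi (u : R) : R := (1 - u / 2) `^ (q - 1) - 1.

Definition phi_moment (j : nat) : R :=
  \int[mu]_(u in `[0, 1]) ((1 - u) ^+ j.-1 * phi u).

Lemma phi_ge0 (u : R) : 0 <= u <= 1 -> 0 <= phi u.
Proof.
move=> /andP[u0 u1]; rewrite subr_ge0.
have h : 0 < 1 - u / 2 <= 1 by apply/andP; split; lra.
by rewrite -[leLHS](powRr0 (1 - u / 2)) ger_powR//; move: q_lt; lra.
Qed.

(** As [q - 1 >= -2], it suffices to bound [(1 - u/2)^-2] by its chord [1 + 3u] over [[0, 1]]. *)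
Lemma phi_le (u : R) : 0 <= u <= 1 -> phi u <= 3 * u.
Proof.
move=> /andP[u0 u1]; rewrite lerBlDr.
have h : 0 < 1 - u / 2 <= 1 by apply/andP; split; lra.
have h0 : 0 < 1 - u / 2 by case/andP: h.
apply: (@le_trans _ _ ((1 - u / 2) `^ (- 2%:R))).
  by rewrite ger_powR//; move: q_ge; lra.
rewrite powR_invn ?(ltW h0)// -[leLHS]mul1r ler_pdivrMr ?exprn_gt0//.
(* This product equals [(1 + 3u) (1 - u/2)^2 - 1]. *)
have : 0 <= u * (1 - u) * (2 - 3 / 4 * u) by rewrite !mulr_ge0//; lra.
by nra.
Qed.

Lemma derivable_onemX_phi n u : u < 2 ->
  derivable (fun u : R => (1 - u) ^+ n * phi u) u 1.
Proof.
move=> u2; apply: (@derivableM _ _ (fun u : R => (1 - u) ^+ n) phi).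
  exact: (@ex_derive _ _ _ _ _ _ _ (is_derive_onemX n u)).
apply: (@derivableB _ _ _ (fun u : R => (1 - u / 2) `^ (q - 1)) (cst 1)).
  exact: (@ex_derive _ _ _ _ _ _ _ (is_derive_half_powR (q - 1) u2)).
exact: derivable_cst.
Qed.

Lemma integrable_onemX_phi n :
  mu.-integrable `[0, 1] (EFin \o (fun u : R => (1 - u) ^+ n * phi u)).
Proof. by apply: derivable_integrable01 => u; exact: derivable_onemX_phi. Qed.

Lemma phi_moment_ge0 j : 0 <= phi_moment j.
Proof.
apply: Rintegral_ge0 => u /=; rewrite in_itv/= => u01.
rewrite mulr_ge0 ?phi_ge0// exprn_ge0// subr_ge0.
by case/andP: u01.
Qed.

(** Replace [phi u] by [3 u] and evaluate a Beta integral. The quadratic decay makes the moments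
    summable against the coefficients [walk_var j / j]. *)
Lemma phi_moment_le j : (0 < j)%N -> phi_moment j <= 3 / (j%:R * j.+1%:R).
Proof.
case: j => // j _; rewrite /phi_moment /=.
have d (u : R) : u < 2 -> derivable (fun u : R => (1 - u) ^+ j * (3 * u)) u 1.
  move=> _; apply: (@derivableM _ _ (fun u : R => (1 - u) ^+ j) (fun u : R => 3 * u)).
    exact: (@ex_derive _ _ _ _ _ _ _ (is_derive_onemX j u)).
  by apply: derivableM => //; exact: derivable_cst.
apply: (@le_trans _ _ (\int[mu]_(u in `[0, 1]) ((1 - u) ^+ j * (3 * u)))).
  apply: le_Rintegral => //.
  - exact: integrable_onemX_phi.
  - exact: derivable_integrable01.
  move=> u /=; rewrite in_itv/= => u01; rewrite ler_wpM2l ?phi_le// exprn_ge0// subr_ge0.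
  by case/andP: u01.
(* A primitive of [3 u (1 - u)^j], found by writing [u = 1 - (1 - u)]. *)
pose h (u : R) : R := - (3 / j.+1%:R) * (1 - u) ^+ j.+1 + (3 / j.+2%:R) * (1 - u) ^+ j.+2.
have -> : \int[mu]_(u in `[0, 1]) ((1 - u) ^+ j * (3 * u)) = h 1 - h 0.
  apply: (Rintegral01_derive d) => u u2.
  have D1 := is_derive_mulC (- (3 / j.+1%:R)) (is_derive_onemX j.+1 u).
  have D2 := is_derive_mulC (3 / j.+2%:R) (is_derive_onemX j.+2 u).
  apply: (is_derive_eq (is_deriveD D1 D2)).
  rewrite /GRing.scale /= exprS.
  have e1 : j.+1%:R != 0 :> R by rewrite pnatr_eq0.
  have e2 : j.+2%:R != 0 :> R by rewrite pnatr_eq0.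
  by move: (j.+1%:R) (j.+2%:R) e1 e2 => a b e1 e2; field; rewrite ?e1 ?e2.
rewrite /h !subrr !expr0n /= !mulr0 add0r subr0 !expr1n !mulr1 sub0r opprD opprK.
rewrite -(natr1 j.+1).
have e1 : j.+1%:R != 0 :> R by rewrite pnatr_eq0.
have e2 : j.+1%:R + 1 != 0 :> R by rewrite natr1 pnatr_eq0.
rewrite le_eqVlt; apply/orP; left; apply/eqP.
by move: (j.+1%:R) e1 e2 => a e1 e2; field; rewrite e1 e2.
Qed.

(* [(-1) ^ j * rho j * W_j] is the conditional expectation given [F_j] of the
   tail of the series [\sum_k (-1) ^ k * W_k / k] starting at [k = j]. *)
Definition rho (j : nat) : R := (phi_moment j + j%:R^-1) / 2.

(** This is the one-step consistency of the conditional tail, since the mean of [W_(j+1)] given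
    [F_j] is [(1 + q/j) W_j]. In terms of [phi_moment], the integrand is an exact derivative. *)
Lemma rho_recurrence j : (0 < j)%N ->
  j%:R * rho j + (j%:R + q) * rho j.+1 = 1.
Proof.
case: j => // j _; rewrite /rho.
have e1 : j.+1%:R != 0 :> R by rewrite pnatr_eq0.
have e2 : j.+2%:R != 0 :> R by rewrite pnatr_eq0.
suff : j.+1%:R * phi_moment j.+1 + (j.+1%:R + q) * phi_moment j.+2 =
    1 - (j.+1%:R + q) / j.+2%:R.
  move: (phi_moment j.+1) (phi_moment j.+2) (j.+1%:R) (j.+2%:R) e1 e2 => x y a b e1 e2 h.
  transitivity ((a * x + (a + q) * y + 1 + (a + q) / b) / 2).
    by field; rewrite e1 e2.
  by rewrite h; field.
rewrite /phi_moment /= -!RintegralZl//; [|exact: integrable_onemX_phi..].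
have dl n c (u : R) : u < 2 -> derivable (fun u : R => c * ((1 - u) ^+ n * phi u)) u 1.
  move=> u2; apply: derivableM; first exact: derivable_cst.
  exact: derivable_onemX_phi.
rewrite -RintegralD//; [|by apply: derivable_integrable01; apply: dl..].
(* Because [2 (1 - u/2) = 1 + (1 - u)], differentiating the first summand gives both terms with
   [(1 - u/2)^(q-1)]; the other two summands account for the [-1] in [phi]. *)
pose h (u : R) : R := -2 * ((1 - u) ^+ j.+1 * (1 - u / 2) `^ q) +
   ((1 - u) ^+ j.+1 + (j.+1%:R + q) / j.+2%:R * (1 - u) ^+ j.+2).
rewrite [LHS](_ : _ = h 1 - h 0).
  rewrite /h !subrr !expr0n /= !mulr0 mul0r mulr0 add0r subr0 mul0r subr0.
  by rewrite !expr1n powR1; ring.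
have dD (u : R) : u < 2 -> derivable (fun u : R =>
    j.+1%:R * ((1 - u) ^+ j * phi u) + (j.+1%:R + q) * ((1 - u) ^+ j.+1 * phi u)) u 1.
  by move=> u2; apply: derivableD; exact: dl.
apply: (Rintegral01_derive dD) => u u2.
have D1 := is_derive_mulC (-2)
   (is_deriveM (is_derive_onemX j.+1 u) (is_derive_half_powR q u2)).
have D2 := is_derive_mulC ((j.+1%:R + q) / j.+2%:R) (is_derive_onemX j.+2 u).
apply: (is_derive_eq (is_deriveD D1 (is_deriveD (is_derive_onemX j.+1 u) D2))).
rewrite /GRing.scale /= /phi.
have u0 : 0 < 1 - u / 2 by lra.
have -> : (1 - u / 2) `^ q = (1 - u / 2) * (1 - u / 2) `^ (q - 1).
  move: (1 - u / 2) u0 => x x0.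
  by rewrite powRB ?(gt_eqF x0) ?implybT// powRr1 ?(ltW x0)// mulrC divfK ?gt_eqF.
rewrite exprS; move: (_ `^ _) (_ ^+ j) (j.+1%:R) (j.+2%:R) e1 e2 => P Q a b e1 e2.
by field.
Qed.

End Moments.

(** * The generating series of the coefficients y_j *)

Section GeneratingSeries.
Variables (R : realType) (q : R) (y : nat -> R).
Hypothesis q_lt : q < 1.
Hypothesis y1 : y 1%N = 1.
Hypothesis yS : forall j, (0 < j)%N ->
  j.+1%:R * y j.+1 = 1 + (j%:R + 2 * q) * y j.
Hypothesis y_ge0 : forall j, 0 <= y j.
Hypothesis y_le : forall j, y j <= j%:R.
Hypothesis q_ge : -1 <= q.

Let G N (t : R) : R := \sum_(1 <= j < N.+1) y j * t ^+ j.
Let dG N (t : R) : R := \sum_(1 <= j < N.+1) j%:R * y j * t ^+ j.-1.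

Let is_derive_G N (t : R) : is_derive t 1 (G N) (dG N t).
Proof.
elim: N => [|N IH].
  have -> : G 0 = cst 0 by apply/funext => x; rewrite /G big_geq.
  by rewrite /dG big_geq//; exact: is_derive_cst.
have -> : G N.+1 = G N \+ (fun x => y N.+1 * x ^+ N.+1).
  by apply/funext => x; rewrite /G big_nat_recr.
have d : is_derive t (1 : R) (fun x : R => x ^+ N.+1) (N.+1%:R * t ^+ N).
  have -> : (fun x : R => x ^+ N.+1) = (id : R -> R) ^+ N.+1.
    by apply/funext => x; rewrite exprfctE.
  by apply: (is_derive_eq (is_deriveX N.+1 (is_derive_id t (1:R)))); rewrite /GRing.scale /= mulr1.
apply: (is_derive_eq (is_deriveD IH (is_derive_mulC (y N.+1) d))).
by rewrite /dG [RHS]big_nat_recr//= mulrA (mulrC (y N.+1)).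
Qed.

(** The recurrence [yS] says that the full series solves [(1 - t) G' - 2 q G = 1 / (1 - t)].
    Truncation at [N] leaves an error carrying the factor [t^N]. *)
Let ode N t : (0 < N)%N -> (1 - t) * ((1 - t) * dG N t - 2 * q * G N t) - 1 =
  - t ^+ N * (1 + (1 - t) * ((N%:R + 2 * q) * y N)).
Proof.
case: N => // N _; elim: N => [|N IH].
  by rewrite /dG /G !big_nat1 y1 expr0 expr1; ring.
have e : dG N.+2 t = dG N.+1 t + N.+2%:R * y N.+2 * t ^+ N.+1.
  by rewrite /dG big_nat_recr.
have e' : G N.+2 t = G N.+1 t + y N.+2 * t ^+ N.+2 by rewrite /G big_nat_recr.
rewrite e e' yS//.
transitivity (((1 - t) * ((1 - t) * dG N.+1 t - 2 * q * G N.+1 t) - 1) +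
  (1 - t) * ((1 - t) * (1 + (N.+1%:R + 2 * q) * y N.+1) * t ^+ N.+1 - 2 * q * y N.+2 * t ^+ N.+2)).
  by ring.
rewrite IH.
have := yS (ltn0Sn N); move: (y N.+1) (y N.+2) => a b h.
have -> : (N.+2%:R + 2 * q) * b = 1 + (N.+1%:R + 2 * q) * a + 2 * q * b by rewrite -h; ring.
by rewrite [t ^+ N.+2]exprS; ring.
Qed.

(** Let [t] be the fourth root of [s]. Then [N t^N] is at most the geometric sum, hence at most
    [1 / (1 - t)], and [N^2 s^N = (N t^N)^2 (t^2)^N] is dominated by a geometric sequence. *)
Lemma cvg_sqr_geometric (s : R) : 0 <= s < 1 -> N%:R ^+ 2 * s ^+ N @[N --> \oo] --> 0.
Proof.
move=> /andP[s0 s1]; set r := Num.sqrt s; set t := Num.sqrt r.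
have rs : r ^+ 2 = s by rewrite sqr_sqrtr.
have tr : t ^+ 2 = r by rewrite sqr_sqrtr// sqrtr_ge0.
have r0 : 0 <= r by exact: sqrtr_ge0.
have t0 : 0 <= t by exact: sqrtr_ge0.
have r1 : r < 1 by rewrite -(@ltr_pXn2r _ 2)// ?nnegrE// rs expr1n.
have t1 : t < 1 by rewrite -(@ltr_pXn2r _ 2)// ?nnegrE// tr expr1n.
have b N : N%:R * t ^+ N <= (1 - t)^-1.
  rewrite -[leRHS]mul1r ler_pdivlMr ?subr_gt0//.
  have -> : N%:R * t ^+ N * (1 - t) = (1 - t) * \sum_(i < N) t ^+ N.
    by rewrite sumr_const card_ord -[_ *+ N]mulr_natl; ring.
  apply: (@le_trans _ _ ((1 - t) * \sum_(i < N) t ^+ i)).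
    rewrite ler_wpM2l ?subr_ge0 ?(ltW t1)//; apply: ler_sum => i _.
    by apply: ler_wiXn2l => //; [exact: ltW | exact: ltnW].
  rewrite -opprB mulNr -subrX1 opprB gerBl exprn_ge0//.
have r1' : `|r| < 1 by rewrite ger0_norm.
have := cvg_geometric ((1 - t) ^- 2) r1'.
apply: squeeze_cvgr; last exact: cvg_cst.
near=> N; apply/andP; split; first by rewrite mulr_ge0 ?exprn_ge0.
rewrite /= /geometric /= -rs -exprM mulnC exprM -tr.
have -> : N%:R ^+ 2 * ((t ^+ 2) ^+ N) ^+ 2 = (N%:R * t ^+ N) ^+ 2 * (t ^+ 2) ^+ N.
  have -> : (t ^+ 2) ^+ N = (t ^+ N) ^+ 2 by rewrite -!exprM mulnC.
  by move: (t ^+ N) => w; ring.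
rewrite ler_wpM2r ?exprn_ge0// -exprVn lerXn2r ?nnegrE ?mulr_ge0 ?exprn_ge0//.
by rewrite invr_ge0 subr_ge0 ltW.
Unshelve. all: by end_near. Qed.

(* Multiplying the partial sum [G N] by the integrating factor [(1 - t) ^ 2q]
   reduces the claim to the mean value theorem. *)
Lemma cvg_generating_series (g : R -> R) (s : R) : 0 < s < 1 -> g 0 = 0 ->
  (forall t : R, t < 1 -> is_derive t 1 g ((1 - t) `^ (2 * q - 2))) ->
  \sum_(1 <= j < N) y j * s ^+ j @[N --> \oo] --> (1 - s) `^ (- (2 * q)) * g s.
Proof.
move=> /andP[s0 s1] g0 dg.
(* [H N] vanishes at 0, and its derivative is [(1 - t)^(2q-2)] times the remainder in [ode]. *)
pose H N (t : R) : R := (1 - t) `^ (2 * q) * G N t - g t.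
have dH N (t : R) : (0 < N)%N -> t < 1 -> is_derive t 1 (H N)
    ((1 - t) `^ (2 * q - 2) * (- t ^+ N * (1 + (1 - t) * ((N%:R + 2 * q) * y N)))).
  move=> N0 t1; have x0 : 0 < 1 - t by rewrite subr_gt0.
  have D := @is_derive1_comp _ (fun z : R => z `^ (2 * q)) (fun x : R => 1 - x) t _ _
     (is_derive1_powR (2 * q) x0) (is_derive_onem t).
  apply: (is_derive_eq (is_deriveB (is_deriveM D (is_derive_G N t)) (dg t t1))).
  rewrite -(ode _ N0) /GRing.scale /=.
  move: (1 - t) x0 (dG N t) (G N t) => x x0 a b.
  have e1 : x `^ (2 * q - 1) = x `^ (2 * q - 2) * x.
    rewrite -[in X in _ = _ * X](powRr1 (ltW x0)) -powRD ?(gt_eqF x0) ?implybT//.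
    by congr (_ `^ _); ring.
  have e2 : x `^ (2 * q) = x `^ (2 * q - 2) * x ^+ 2.
    rewrite -(powR_mulrn 2 (ltW x0)) -powRD ?(gt_eqF x0) ?implybT//.
    by congr (_ `^ _); ring.
  by rewrite e1 e2; ring.
have G0 N : G N 0 = 0.
  by rewrite /G big_nat big1// => j /andP[j0 _]; rewrite expr0n gtn_eqF// mulr0.
set c := (1 - s) `^ (2 * q - 2).
(* The factor [(1 - t)^(2q-2)] increases with [t], so [c] bounds it on []0, s[]. The 4 comes from
   [1 + (N + 2) N <= 4 N^2], using [|q| <= 1] and [y N <= N]. *)
have bound N : (0 < N)%N -> `|H N s| <= c * 4 * (N%:R ^+ 2 * s ^+ N).
  move=> N0.
  have [||t] := @MVT _ (H N) (fun t => (1 - t) `^ (2 * q - 2) *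
    (- t ^+ N * (1 + (1 - t) * ((N%:R + 2 * q) * y N)))) 0 s s0.
  - by move=> t; rewrite in_itv/= => /andP[_ ts]; apply: dH => //; exact: lt_trans ts _.
  - apply: continuous_in_subspaceT => t; rewrite inE /= in_itv /= => /andP[_ ts].
    apply: derivable_cont; apply: (@ex_derive _ _ _ _ _ _ _ (dH N t N0 _)).
    exact: le_lt_trans ts _.
  rewrite in_itv/= => /andP[t0 ts]; rewrite /H G0 g0 !mulr0 !subr0 => ->.
  rewrite !normrM normrN normrX.
  have t1 : 0 <= 1 - t by lra.
  have NR : 1 <= N%:R :> R by rewrite ler1n.
  have h1 : `|(1 - t) `^ (2 * q - 2)| <= c.
    rewrite ger0_norm ?powR_ge0// /c.
    have -> : 2 * q - 2 = - (2 - 2 * q) by ring.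
    rewrite !powRN lef_pV2 ?posrE ?powR_gt0 ?subr_gt0//; last exact: lt_trans ts _.
    rewrite ge0_ler_powR ?nnegrE//; [move: q_lt; lra|lra|lra].
  have h2 : `|t| ^+ N <= s ^+ N.
    by rewrite ger0_norm ?(ltW t0)// lerXn2r ?nnegrE ?(ltW t0) ?(ltW s0)// ltW.
  have h3 : `|1 + (1 - t) * ((N%:R + 2 * q) * y N)| <= 4 * N%:R ^+ 2.
    rewrite (le_trans (ler_normD _ _))// normr1 normrM normrM.
    rewrite (ger0_norm (y_ge0 N)) (ger0_norm t1).
    have k1 : `|N%:R + 2 * q| <= N%:R + 2.
      by rewrite ler_norml; apply/andP; split; move: q_ge q_lt; lra.
    have k2 : `|N%:R + 2 * q| * y N <= (N%:R + 2) * N%:R by rewrite ler_pM.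
    apply: (@le_trans _ _ (1 + 1 * ((N%:R + 2) * N%:R))).
      by rewrite lerD2l ler_pM// ?mulr_ge0//; lra.
    by move: NR; nra.
  have h4 : `|s| <= 1 by rewrite ger0_norm ltW.
  apply: (@le_trans _ _ (c * (s ^+ N * (4 * N%:R ^+ 2)) * 1)); last first.
    by rewrite le_eqVlt; apply/orP; left; apply/eqP; ring.
  by rewrite !ler_pM ?mulr_ge0 ?exprn_ge0.
have cvgH : H N s @[N --> \oo] --> 0.
  apply: norm_cvg0.
  have sq : 0 <= s < 1 by rewrite (ltW s0).
  have lim0 := cvgMr (a := c * 4) (cvg_sqr_geometric sq); rewrite mulr0 in lim0.
  apply: (@squeeze_cvgr _ _ _ _ (fun=> 0) (fun N => c * 4 * (N%:R ^+ 2 * s ^+ N)));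
    [|exact: cvg_cst|exact: lim0].
  near=> N; rewrite normr_ge0 bound//; near: N; exact: nbhs_infty_gt.
rewrite -cvg_shiftS /=.
have x0 : 0 < 1 - s by rewrite subr_gt0.
have -> : (fun N => \sum_(1 <= j < N.+1) y j * s ^+ j) =
    (fun N => (1 - s) `^ (- (2 * q)) * (H N s + g s)).
  apply/funext => N; rewrite /H subrK mulrA -powRD ?(gt_eqF x0) ?implybT//.
  by rewrite addNr powRr0 mul1r.
have lim := cvgMr (a := (1 - s) `^ (- (2 * q))) (cvgD cvgH (cvg_cst (g s))).
by rewrite add0r in lim; exact: lim.
Unshelve. all: by end_near. Qed.

End GeneratingSeries.

(** * Termwise integration of the series against phi *)

Section MomentSeries.
Variables (R : realType) (q : R) (y : nat -> R) (K : R -> R) (M : R).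
Hypotheses (q_lt : q < 1) (y_ge0 : forall j, 0 <= y j).
Hypothesis sum_le : forall N, \sum_(1 <= j < N) y j * phi_moment q j <= M.
Hypothesis cvgK : forall u : R, 0 < u < 1 ->
  \sum_(1 <= j < N) y j * (1 - u) ^+ j.-1 * phi q u @[N --> \oo] --> K u.
Local Notation mu := (@lebesgue_measure R).

Let f N (u : R) : R := \sum_(1 <= j < N) y j * ((1 - u) ^+ j.-1 * phi q u).

Let derivable_f N (u : R) : u < 2 -> derivable (f N) u 1.
Proof.
move=> u2; elim: N => [|[|N] IH].
- have -> : f 0 = cst 0 by apply/funext => x; rewrite /f big_geq.
  exact: derivable_cst.
- have -> : f 1 = cst 0 by apply/funext => x; rewrite /f big_geq.
  exact: derivable_cst.
have -> : f N.+2 = f N.+1 \+ (fun x => y N.+1 * ((1 - x) ^+ N * phi q x)).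
  by apply/funext => x; rewrite /f big_nat_recr.
apply: (derivableD IH); apply: derivableM; first exact: derivable_cst.
exact: derivable_onemX_phi.
Qed.

Let Rintegral_f N : \int[mu]_(u in `[0, 1]) f N u = \sum_(1 <= j < N) y j * phi_moment q j.
Proof.
elim: N => [|[|N] IH].
- rewrite big_geq// -[RHS](mul0r (fine (mu `[0, 1]))) -Rintegral_cst//.
  by apply: eq_Rintegral => u _; rewrite /f big_geq.
- rewrite big_geq// -[RHS](mul0r (fine (mu `[0, 1]))) -Rintegral_cst//.
  by apply: eq_Rintegral => u _; rewrite /f big_geq.
rewrite big_nat_recr//= -IH /phi_moment /=.
rewrite -RintegralZl//; last exact: integrable_onemX_phi.
rewrite -RintegralD//.
- by apply: eq_Rintegral => u _; rewrite /f big_nat_recr.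
- by apply: derivable_integrable01 => u; exact: derivable_f.
apply: derivable_integrable01 => u u2; apply: derivableM; first exact: derivable_cst.
exact: derivable_onemX_phi.
Qed.

(** The series is known to converge only on the open interval, while the stated integral is over the
    closed one. *)
Let integral_oo (h : R -> R) : measurable_fun `](0 : R), 1[ h ->
  (\int[mu]_(u in `]0%R, 1%R[) (h u)%:E = \int[mu]_(u in `[0%R, 1%R]) (h u)%:E)%E.
Proof.
move=> mh; have mh' : measurable_fun `](0 : R), 1] h by apply/measurable_fun_itv_bndo_bndcP.
by rewrite integral_itv_bndo_bndc ?integral_itv_obnd_cbnd//; exact/measurable_EFinP.
Qed.

(** The terms are nonnegative inside the interval, so monotone convergence identifies the limit; the
    bound [M] on the partial sums makes the limiting integral finite, hence [K] integrable. *)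
Lemma cvg_phi_moment_series : mu.-integrable `[0, 1] (EFin \o K) /\
  \sum_(1 <= j < N) y j * phi_moment q j @[N --> \oo] -->
  \int[mu]_(u in `[0, 1]) K u.
Proof.
have f_ge0 j u : 0 < u < 1 -> 0 <= y j * ((1 - u) ^+ j.-1 * phi q u).
  move=> /andP[u0 u1]; apply: mulr_ge0 => //; apply: mulr_ge0.
    by rewrite exprn_ge0// subr_ge0 ltW.
  by apply: phi_ge0 => //; rewrite !ltW.
have mf N : measurable_fun `](0 : R), 1[ (f N).
  have : mu.-integrable `[0, 1] (EFin \o f N).
    by apply: derivable_integrable01 => u; exact: derivable_f.
  move=> /measurable_int/measurable_EFinP; apply: measurable_funS => //.
  by apply: subset_itvW.
have cvgf u : 0 < u < 1 -> f N u @[N --> \oo] --> K u.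
  move=> u01; have -> : f ^~ u = fun N => \sum_(1 <= j < N) y j * (1 - u) ^+ j.-1 * phi q u.
    by apply/funext => N; apply: eq_bigr => j _; rewrite mulrA.
  exact: cvgK.
have mK : measurable_fun `](0 : R), 1[ K.
  by apply: (measurable_fun_cvg mf) => u /=; rewrite in_itv/=; exact: cvgf.
have fE N : (\int[mu]_(u in `]0%R, 1%R[) (f N u)%:E =
    (\sum_(1 <= j < N) y j * phi_moment q j)%:E)%E.
  rewrite integral_oo// -Rintegral_f /Rintegral fineK// integrable_fin_num//.
  by apply: derivable_integrable01 => u; exact: derivable_f.
have nd u : 0 < u < 1 -> nondecreasing_seq (f ^~ u).
  move=> u01; apply/nondecreasing_seqP => -[|N]; first by rewrite /f !big_geq.
  by rewrite /f [leRHS]big_nat_recr//= lerDl f_ge0.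
have cvgI : ((\sum_(1 <= j < N) y j * phi_moment q j)%:E @[N --> \oo] -->
    \int[mu]_(u in `[0%R, 1%R]) (K u)%:E)%E.
  rewrite -integral_oo//.
  have -> : (\int[mu]_(u in `]0%R, 1%R[) (K u)%:E =
      \int[mu]_(u in `]0%R, 1%R[) limn (fun N => (f N u)%:E))%E.
    apply: eq_integral => u; rewrite inE /= in_itv /= => u01.
    apply/esym/cvg_lim => //; apply: cvg_EFin; first exact: nearW.
    exact: cvgf.
  under eq_fun do rewrite -fE.
  apply: cvg_monotone_convergence => //.
  - by move=> N; apply: measurableT_comp => //; exact: mf.
  - move=> N u /=; rewrite in_itv/= => u01; rewrite lee_fin.
    by apply: sumr_ge0 => j _; exact: f_ge0.
have fin : (\int[mu]_(u in `[0%R, 1%R]) (K u)%:E)%E \is a fin_num.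
  rewrite fin_numE; apply/andP; split.
    rewrite gt_eqF// (lt_le_trans (ltNyr 0))//.
    rewrite -(cvg_lim _ cvgI)//; apply: lime_ge; first by apply/cvg_ex; eexists; exact: cvgI.
    apply: nearW => N; rewrite lee_fin sumr_ge0// => j _; rewrite mulr_ge0//.
    exact: phi_moment_ge0.
  rewrite lt_eqF// (le_lt_trans _ (ltry M))//.
  rewrite -(cvg_lim _ cvgI)//; apply: lime_le; first by apply/cvg_ex; eexists; exact: cvgI.
  by apply: nearW => N; rewrite lee_fin.
have mKc : measurable_fun `[(0 : R), 1] K.
  by apply/measurable_fun_itv_obnd_cbndP/measurable_fun_itv_bndo_bndcP.
split; last by move: cvgI; rewrite -(fineK fin) => /fine_cvg.
apply/integrableP; split; first exact/measurable_EFinP.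
by rewrite integral_fin_num_abs.
Qed.

End MomentSeries.

(** * Words and their law *)

Section Words.
Variable R : realType.
Implicit Types (s : seq bool) (b : bool).

Definition sgb b : R := if b then 1 else -1.

(** The processes are recast as functions of the finite word of steps, so that their moments become
    finite sums. *)
Definition walk s : R := (count id s)%:R - (count negb s)%:R.

Definition signed_length (w : seq bool) : R :=
  if w is [::] then 0 else if last false w then (size w)%:R else - (size w)%:R.

Definition location s : R := signed_length (foldl lmul [::] s).

Lemma walk_rcons s b : walk (rcons s b) = walk s + sgb b.
Proof.
rewrite /walk -cats1 !count_cat /= !addn0 !natrD.
by case: b; rewrite /sgb /=; ring.
Qed.

(* The reduced word of length [n] with rightmost letter [b]. *)
Fixpoint alt_word b n : seq bool :=
  if n is m.+1 then (b (+) odd m) :: alt_word b m else [::].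

Lemma size_alt_word b n : size (alt_word b n) = n.
Proof. by elim: n => //= n ->. Qed.

Lemma last_alt_word b n d : last d (alt_word b n.+1) = b.
Proof.
elim: n d => [|n IH] d; first by rewrite /= addbF.
by rewrite -[RHS](IH (b (+) odd n.+1)).
Qed.

Lemma signed_length_alt_word b n : signed_length (alt_word b n) = sgb b * n%:R.
Proof.
case: n => [|n]; first by rewrite mulr0.
rewrite /signed_length /= size_alt_word.
have := last_alt_word b n false; rewrite /= => ->.
by case: b; rewrite /sgb ?mul1r ?mulN1r.
Qed.

(** The leading letter is determined by [b] and the parity of [n], so the new letter cancels it or
    extends the word according to that parity. The empty word has no rightmost letter of its own,
    hence the new [b']. *)
Lemma lmul_alt_word b n c : exists b' n',
  [/\ lmul (alt_word b n) c = alt_word b' n', odd n' = ~~ odd n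
    & sgb b' * n'%:R = sgb b * n%:R + (-1) ^+ n * sgb c].
Proof.
case: n => [|n].
  by exists c, 1%N; split; rewrite //= ?addbF// mulr0 add0r mulr1 expr0 mul1r.
rewrite [lmul _ _]/=; case: eqP => [<-|/eqP neq].
  exists b, n; split => //=; first by rewrite negbK.
  rewrite -natr1 exprS -signr_odd; case: b; case: (odd n) => /=;
    rewrite /sgb ?expr0 ?expr1; ring.
have -> : c = b (+) odd n.+1 by move: neq; rewrite /=; case: b; case: (odd n); case: c.
clear neq; exists b, n.+2; split => //.
rewrite -(natr1 n.+1) -signr_odd /=; case: b; case: (odd n) => /=;
    rewrite /sgb ?expr0 ?expr1; ring.
Qed.

Lemma foldl_lmul_alt_word s : exists b n,
  [/\ foldl lmul [::] s = alt_word b n & odd n = odd (size s)].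
Proof.
elim/last_ind: s => [|s c [b [n [e o]]]]; first by exists true, 0%N.
rewrite -cats1 foldl_cat /= e size_cat /= addn1 /= -o.
by have [b' [n' [-> o' _]]] := lmul_alt_word b n c; exists b', n'.
Qed.

(** The length of the reduced word has the parity of the number of steps, so the sign of a
    displacement depends on time alone. This makes the signed location an alternating sum of the
    steps. *)
Lemma location_rcons s b :
  location (rcons s b) = location s + (-1) ^+ size s * sgb b.
Proof.
rewrite /location -cats1 foldl_cat /=.
have [c [n [-> o]]] := foldl_lmul_alt_word s.
have [b' [n' [-> _ h]]] := lmul_alt_word c n b.
by rewrite !signed_length_alt_word h -(signr_odd _ n) o signr_odd.
Qed.

Lemma location_nil : location [::] = 0. Proof. by []. Qed.
Lemma walk_nil : walk [::] = 0. Proof. by rewrite /walk /= subrr. Qed.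

Lemma walk_le s : `|walk s| <= (size s)%:R.
Proof.
elim/last_ind: s => [|s b IH]; first by rewrite walk_nil normr0.
rewrite walk_rcons size_rcons -natr1 (le_trans (ler_normD _ _))// lerD//.
by case: b; rewrite /sgb ?normrN normr1.
Qed.

(** A general starting index [m] lets one computation treat both [S_n] and the differences
    [S_n - S_m]. *)
Definition altsum m s : R :=
  \sum_(m <= k < size s) (-1) ^+ k * walk (take k s) / k%:R.

Lemma altsum_rcons m s b : (m <= size s)%N ->
  altsum m (rcons s b) = altsum m s + (-1) ^+ size s * walk s / (size s)%:R.
Proof.
move=> ms; rewrite /altsum size_rcons big_nat_recr//=; congr (_ + _).
  rewrite !big_nat; apply: eq_bigr => k /andP[_ ks].
  by rewrite -cats1 takel_cat// ltnW.
by rewrite -cats1 take_size_cat.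
Qed.

Lemma altsum_size m s : (size s <= m)%N -> altsum m s = 0.
Proof. by move=> sm; rewrite /altsum big_geq. Qed.

Fixpoint words n : seq (seq bool) :=
  if n is m.+1 then [seq rcons s b | s <- words m, b <- [:: true; false]]
  else [:: [::]].

Lemma wordsS n :
  words n.+1 = [seq rcons s b | s <- words n, b <- [:: true; false]].
Proof. by []. Qed.

Lemma mem_words n s : (s \in words n) = (size s == n).
Proof.
elim: n s => [|n IH] s; first by rewrite inE; case: s.
apply/allpairsP/idP => [[[t b] /= [tn _ ->]]|/eqP].
  by rewrite size_rcons eqSS -IH.
case/lastP: s => // s b; rewrite size_rcons => -[sn].
by exists (s, b); rewrite /= IH sn eqxx; split => //; case: b.
Qed.

Lemma words_uniq n : uniq (words n).
Proof.
elim: n => // n IH; apply/allpairs_uniq_dep => // -[s b] [t c] _ _ /=.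
by move=> /rcons_inj[-> ->].
Qed.

End Words.
Arguments walk {R} s.
Arguments location {R} s.
Arguments sgb {R} b.
Arguments altsum {R} m s.

(** * Expectations over words of steps and moment recurrences *)

Section Expectation.
Variables (R : realType) (p : R).
Hypotheses (hp0 : 0 <= p) (hp1 : p < 1).
Local Notation q := (2 * p - 1).
Implicit Types (s : seq bool) (b : bool) (f h : seq bool -> R).

Lemma erw_prob_rcons s b : erw_prob p (rcons s b) = erw_prob p s * step_prob p s b.
Proof.
rewrite /erw_prob size_rcons big_ord_recr /=; congr (_ * _).
  apply: eq_bigr => i _; rewrite nth_rcons ltn_ord; congr step_prob.
  by rewrite -cats1 takel_cat// ltnW.
by rewrite -cats1 take_size_cat// nth_cat ltnn subnn.
Qed.

(** The formula also covers the first step: for the empty word the drift is 0, because the inverse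
    of 0 is 0. *)
Lemma step_probE s b :
  step_prob p s b = (1 + sgb b * (q * walk s / (size s)%:R)) / 2.
Proof.
case: s => [|c s]; first by rewrite /step_prob /= invr0 !mulr0 addr0.
rewrite /step_prob; set t := c :: s.
have t0 : (size t)%:R != 0 :> R by rewrite pnatr_eq0.
have e : (size t)%:R = (count id t)%:R + (count negb t)%:R :> R.
  by rewrite -natrD -(count_predC id t).
rewrite /walk; case: b; rewrite /sgb; rewrite e; rewrite e in t0; field; exact: t0.
Qed.

Lemma norm_drift_le1 s : `|q * walk s / (size s)%:R| <= 1 :> R.
Proof.
have [s0|s0] := posnP (size s); first by rewrite s0 invr0 mulr0 normr0.
rewrite -mulrA normrM normf_div (ger0_norm (ler0n _ _)).
have h1 : `|q| <= 1 by rewrite ler_norml; apply/andP; split; move: hp0 hp1; lra.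
have h2 : `|walk s| / (size s)%:R <= 1 :> R.
  by rewrite ler_pdivrMr ?ltr0n// mul1r walk_le.
by rewrite mulr_ile1// divr_ge0.
Qed.

Lemma step_prob_ge0 s b : 0 <= step_prob p s b.
Proof.
rewrite step_probE divr_ge0// -lerBlDl sub0r lerNl.
apply: le_trans (ler_norm _) _; rewrite normrN normrM.
have -> : `|sgb b| = 1 :> R by case: b; rewrite /sgb ?normrN normr1.
by rewrite mul1r norm_drift_le1.
Qed.

Lemma erw_prob_ge0 s : 0 <= erw_prob p s.
Proof. by apply: prodr_ge0 => i _; exact: step_prob_ge0. Qed.

Definition Ex n f : R := \sum_(s <- words n) erw_prob p s * f s.

Lemma eq_Ex n f h : (forall s, size s = n -> f s = h s) -> Ex n f = Ex n h.
Proof.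
by move=> e; apply: eq_big_seq => s; rewrite mem_words => /eqP/e ->.
Qed.

Lemma le_Ex n f h : (forall s, size s = n -> f s <= h s) -> Ex n f <= Ex n h.
Proof.
move=> e; rewrite /Ex !big_seq; apply: ler_sum => s.
by rewrite mem_words => /eqP/e ?; rewrite ler_wpM2l ?erw_prob_ge0.
Qed.

Lemma ExD n f h : Ex n (fun s => f s + h s) = Ex n f + Ex n h.
Proof. by rewrite /Ex -big_split; apply: eq_bigr => s _; rewrite mulrDr. Qed.

Lemma ExZ n c f : Ex n (fun s => c * f s) = c * Ex n f.
Proof. by rewrite /Ex big_distrr; apply: eq_bigr => s _ /=; ring. Qed.

Lemma Ex_ge0 n f : (forall s, size s = n -> 0 <= f s) -> 0 <= Ex n f.
Proof.
move=> e; rewrite -(mul0r (Ex n f)) -ExZ; apply: le_Ex => s /e.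
by rewrite mul0r.
Qed.

Lemma ExS n f : Ex n.+1 f =
  Ex n (fun s => step_prob p s true * f (rcons s true) +
                 step_prob p s false * f (rcons s false)).
Proof.
rewrite /Ex wordsS big_allpairs_dep; apply: eq_bigr => s _.
rewrite !big_cons big_nil !erw_prob_rcons /=.
by ring.
Qed.

(** Conditioning on the first [n] steps splits [f] into its even and odd parts in the last letter;
    only the odd part feels the drift. The moment recurrences below all reduce to this identity and
    linear arithmetic. *)
Lemma ExS_drift n f : Ex n.+1 f =
  Ex n (fun s => (f (rcons s true) + f (rcons s false)) / 2 +
     q * walk s / n%:R * ((f (rcons s true) - f (rcons s false)) / 2)).
Proof.
rewrite ExS; apply: eq_Ex => s sn; rewrite !step_probE sn /sgb.
by set m := _ / n%:R; lra.
Qed.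

Lemma Ex1 n : Ex n (fun=> 1) = 1.
Proof.
elim: n => [|n IH].
  by rewrite /Ex big_seq1 /erw_prob big_ord0 mulr1.
by rewrite ExS_drift -[RHS]IH; apply: eq_Ex => s _; lra.
Qed.

Lemma Ex_cst n c : Ex n (fun=> c) = c.
Proof. by rewrite -[RHS]mulr1 -(Ex1 n) -ExZ; apply: eq_Ex => s _; rewrite mulr1. Qed.

Lemma Ex_walk n : Ex n walk = 0.
Proof.
elim: n => [|n IH]; first by rewrite /Ex big_seq1 walk_nil mulr0.
rewrite ExS_drift -[RHS](mulr0 (1 + q / n%:R)) -IH -ExZ; apply: eq_Ex => s sn.
by rewrite !walk_rcons /sgb; lra.
Qed.

Lemma Ex_altsum m n : Ex n (altsum m) = 0.
Proof.
elim: n => [|n IH].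
  by rewrite /Ex big_seq1 /altsum big_geq// mulr0.
have [mn|nm] := leqP m n; last first.
  rewrite -[RHS](Ex_cst n.+1); apply: eq_Ex => s sn.
  by rewrite altsum_size// sn.
transitivity (Ex n (altsum m) + (-1) ^+ n / n%:R * Ex n walk); last first.
  by rewrite IH Ex_walk mulr0 addr0.
rewrite ExS_drift -ExZ -ExD; apply: eq_Ex => s sn.
by rewrite !altsum_rcons ?sn//; lra.
Qed.

Lemma Ex_location n : Ex n location = 0.
Proof.
elim: n => [|n IH]; first by rewrite /Ex big_seq1 location_nil mulr0.
transitivity (Ex n location + (-1) ^+ n * q / n%:R * Ex n walk); last first.
  by rewrite IH Ex_walk mulr0 addr0.
rewrite ExS_drift -ExZ -ExD; apply: eq_Ex => s sn.
by rewrite !location_rcons sn /sgb; lra.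
Qed.

Definition walk_var n : R := Ex n (fun s => walk s ^+ 2).

Lemma walk_var_ge0 n : 0 <= walk_var n.
Proof. by apply: Ex_ge0 => s _; rewrite sqr_ge0. Qed.

Lemma walk_var1 : walk_var 1 = 1.
Proof.
rewrite /walk_var ExS_drift -[RHS](Ex1 0); apply: eq_Ex => s /eqP; rewrite size_eq0 => /eqP->.
by rewrite !walk_rcons walk_nil /sgb; lra.
Qed.

Lemma walk_varS n : walk_var n.+1 = 1 + (1 + 2 * q / n%:R) * walk_var n.
Proof.
rewrite /walk_var ExS_drift -[X in _ = X + _](Ex1 n) -ExZ -ExD; apply: eq_Ex => s sn.
by rewrite !walk_rcons /sgb; lra.
Qed.

(** The exact recurrence has a cross term [2 (-1)^n q D W / n], which is split as
    [D^2 / (2n) + 2 W^2 / n]. *)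
Lemma Ex_location_sqrS n : Ex n.+1 (fun s => location s ^+ 2) <=
  1 + (1 + n%:R^-1 / 2) * Ex n (fun s => location s ^+ 2) + 2 / n%:R * walk_var n.
Proof.
rewrite /walk_var ExS_drift -[X in X + _ + _](Ex1 n) -!ExZ -!ExD.
apply: le_Ex => s sn; rewrite !location_rcons sn /sgb.
set D := location s; set W := walk s; set e := (-1) ^+ n; set c := n%:R^-1.
have ee : e ^+ 2 = 1 by rewrite /e -exprM mulnC exprM sqrrN expr1n expr1n.
have c0 : 0 <= c by rewrite invr_ge0.
rewrite -subr_ge0.
(* Completing the square exhibits the gap as nonnegative, given [q^2 <= 1]; the last term records
   the use of [e^2 = 1]. *)
have -> : 1 + (1 + c / 2) * D ^+ 2 + 2 / n%:R * W ^+ 2 -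
   (((D + e * 1) ^+ 2 + (D + e * -1) ^+ 2) / 2 +
    q * W / n%:R * (((D + e * 1) ^+ 2 - (D + e * -1) ^+ 2) / 2)) =
   c * ((e * D - 2 * q * W) ^+ 2 / 2 + (1 - q ^+ 2) * 2 * W ^+ 2)
   + (1 - e ^+ 2) * (1 + c * D ^+ 2 / 2) by rewrite -/c; field.
rewrite ee subrr mul0r addr0.
have q2 : 0 <= 1 - q ^+ 2.
  have -> : 1 - q ^+ 2 = 4 * (p * (1 - p)) by ring.
  by rewrite !mulr_ge0// subr_ge0 ltW.
apply: mulr_ge0 => //; apply: addr_ge0; first by rewrite divr_ge0// sqr_ge0.
by apply: mulr_ge0; [apply: mulr_ge0|exact: sqr_ge0].
Qed.

(** * Subquadratic growth of the second moments *)

Section Growth.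
Variables (th q1 : R).
Hypotheses (qq1 : q <= q1) (q1_ge : 1 / 2 <= q1) (q1th : q1 < th) (th1 : th < 1).

Ltac glra := move: qq1 q1_ge q1th th1; lra.

(* A product comparable to [n `^ th], which makes all sums below telescope. *)
Fixpoint growth n : R := if n is m.+1 then growth m * (1 + th / m%:R) else 1.

Lemma growthS n : growth n.+1 = growth n * (1 + th / n%:R).
Proof. by []. Qed.

Lemma growth_gt0 n : 0 < growth n.
Proof.
elim: n => //= n IH; rewrite mulr_gt0// ltr_wpDr// divr_ge0//.
by move: q1_ge q1th; lra.
Qed.

(** As [th >= 1/2], [(1 + th/n)^2 >= 1 + 1/n]. This lets [growth^2 / n] absorb the additive 1 in the
    variance recurrences. *)
Lemma growth_sqr_ge n : n%:R <= growth n ^+ 2.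
Proof.
elim: n => [|[|n] IH]; first by rewrite /= expr1n.
  by rewrite /= invr0 mulr0 addr0 mulr1 expr1n.
rewrite growthS exprMn -natr1.
have n0 : 0 < n.+1%:R :> R by rewrite ltr0n.
set x := n.+1%:R in IH n0 *; set t := growth n.+1 in IH *.
have -> : x + 1 = x * (1 + 1 / x) by field; rewrite gt_eqF.
apply: ler_pM => //; first by rewrite addr_ge0 ?divr_ge0// ltW.
have : 1 / x <= 2 * (th / x) by rewrite mulrA ler_wpM2r ?invr_ge0 ?(ltW n0)//; glra.
have := sqr_ge0 (th / x); set y := th / x; set z := 1 / x; nra.
Qed.

Lemma growth_sqrS n : growth n ^+ 2 * (1 + 2 * th / n%:R) <= growth n.+1 ^+ 2.
Proof.
rewrite growthS exprMn ler_wpM2l ?sqr_ge0//.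
have := sqr_ge0 (th / n%:R); rewrite -mulrA; set x := th / _; nra.
Qed.

(** The drift rate [2 q / n] is below [2 th / n]; the surplus [2 (th - q1) growth^2 / n], multiplied
    by [(th - q1)^-1], pays for the additive 1. *)
Lemma walk_var_le n : walk_var n <= (th - q1)^-1 * growth n ^+ 2.
Proof.
have d0 : 0 < th - q1 by glra.
have C1 : 1 <= (th - q1)^-1 by rewrite invf_ge1//; glra.
elim: n => [|[|n] IH].
- rewrite /walk_var /Ex big_seq1 walk_nil expr0n mulr0 mulr_ge0 ?sqr_ge0//.
  by rewrite ltW// invr_gt0.
- by rewrite walk_var1 /= invr0 mulr0 addr0 mulr1 expr1n mulr1.
rewrite walk_varS.
have := growth_sqr_ge n.+1; have := growth_sqrS n.+1.
have n0 : 0 < n.+1%:R :> R by rewrite ltr0n.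
have := walk_var_ge0 n.+1; move: IH.
set v := walk_var n.+1; set t := growth n.+1 ^+ 2; set t' := growth n.+2 ^+ 2.
set C := (th - q1)^-1 in C1 *; move=> IH v0 h1 h2.
have CE : C * (th - q1) = 1 by rewrite mulVf// gt_eqF.
have Ct0 : 0 <= C * t by apply: le_trans IH.
set c := n.+1%:R^-1; have c0 : 0 <= c by rewrite invr_ge0 ltW.
have ct : 1 <= c * t by rewrite /c mulrC ler_pdivlMr// mul1r.
apply: (@le_trans _ _ (C * (t * (1 + 2 * th / n.+1%:R)))); last first.
  by rewrite ler_wpM2l// (le_trans _ C1).
rewrite -/c; apply: (@le_trans _ _ (1 + (1 + 2 * q1 * c) * (C * t))).
  rewrite lerD2l; apply: (@le_trans _ _ ((1 + 2 * q1 * c) * v)).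
    rewrite ler_wpM2r// lerD2l ler_wpM2r//; glra.
  by rewrite ler_wpM2l// addr_ge0// !mulr_ge0//; glra.
have -> : C * (t * (1 + 2 * th * c)) =
  (1 + 2 * q1 * c) * (C * t) + 2 * (C * (th - q1)) * (c * t) by ring.
by rewrite CE; glra.
Qed.

(** With [C = (th - q1)^-1], half of [(2 + 4 C) growth^2 / n] is [growth^2 / n + 2 C growth^2 / n],
    which covers the additive 1 and the walk term; the remainder is nonnegative since
    [2 th >= 1]. *)
Lemma location_var_le n : Ex n (fun s => location s ^+ 2) <=
  (2 + 4 * (th - q1)^-1) * growth n ^+ 2.
Proof.
have d0 : 0 < th - q1 by glra.
have C1 : 1 <= (th - q1)^-1 by rewrite invf_ge1//; glra.
elim: n => [|[|n] IH].
- rewrite /Ex big_seq1 location_nil expr0n mulr0 mulr_ge0 ?sqr_ge0//; glra.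
- apply: le_trans (Ex_location_sqrS 0) _.
  rewrite /= invr0 mulr0 mul0r !mulr0 mul0r !addr0 mul1r mulr1 expr1n mulr1.
  rewrite /Ex big_seq1 location_nil expr0n mulr0; glra.
apply: le_trans (Ex_location_sqrS n.+1) _.
have := growth_sqr_ge n.+1; have := growth_sqrS n.+1.
have n0 : 0 < n.+1%:R :> R by rewrite ltr0n.
have := walk_var_le n.+1; move: IH.
set d := Ex _ _; set v := walk_var n.+1; set t := growth n.+1 ^+ 2; set t' := growth n.+2 ^+ 2.
set C := (th - q1)^-1 in C1 *; move=> IH vt h1 h2.
set c := n.+1%:R^-1; have c0 : 0 <= c by rewrite invr_ge0 ltW.
have ct : 1 <= c * t by rewrite /c mulrC ler_pdivlMr// mul1r.
apply: (@le_trans _ _ ((2 + 4 * C) * (t * (1 + 2 * th / n.+1%:R)))); last first.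
  by rewrite ler_wpM2l//; glra.
rewrite -/c.
apply: (@le_trans _ _ (1 + (1 + c / 2) * ((2 + 4 * C) * t) + 2 * c * (C * t))).
  by rewrite lerD ?lerD2l ?ler_wpM2l// ?addr_ge0 ?divr_ge0 ?mulr_ge0.
rewrite -subr_ge0.
have -> : (2 + 4 * C) * (t * (1 + 2 * th * c)) -
  (1 + (1 + c / 2) * ((2 + 4 * C) * t) + 2 * c * (C * t)) =
  (2 * th - 1) * (c * t) * (2 + 4 * C) + (c * t - 1) by field.
apply: addr_ge0; last by rewrite subr_ge0.
by apply: mulr_ge0; first apply: mulr_ge0; glra.
Qed.

(** The inequality [x + y <= t + (x^2 + y^2) / (2t)] with [t = growth n] passes from second moments
    to first ones. *)
Lemma Ex_norm_le : exists K : R, 0 <= K /\ forall n,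
  Ex n (fun s => `|walk s| + `|location s|) <= K * growth n.
Proof.
exists (2 + 3 * (th - q1)^-1).
have d0 : 0 <= (th - q1)^-1 by rewrite invr_ge0; glra.
split; first glra.
move=> n; have t0 := growth_gt0 n; set t := growth n in t0 *.
apply: (@le_trans _ _ (Ex n (fun s => t + t^-1 / 2 * (walk s ^+ 2 + location s ^+ 2)))).
  apply: le_Ex => s _; rewrite -(real_normK (num_real (walk s))).
  rewrite -(real_normK (num_real (location s))).
  set x := `|walk s|; set y := `|location s|; rewrite -subr_ge0.
  have -> : t + t^-1 / 2 * (x ^+ 2 + y ^+ 2) - (x + y) =
    t^-1 / 2 * ((t - x) ^+ 2 + (t - y) ^+ 2) by field; rewrite gt_eqF.
  by rewrite mulr_ge0 ?addr_ge0 ?sqr_ge0// divr_ge0// invr_ge0 ltW.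
rewrite ExD ExZ ExD Ex_cst.
have := walk_var_le n; have := location_var_le n; rewrite /walk_var -/t.
set a := Ex _ _; set b := Ex _ _; set C := _^-1 => h1 h2.
apply: (@le_trans _ _ (t + t^-1 / 2 * (C * t ^+ 2 + (2 + 4 * C) * t ^+ 2))).
  by rewrite lerD2l ler_wpM2l ?lerD// divr_ge0// invr_ge0 ltW.
have -> : t + t^-1 / 2 * (C * t ^+ 2 + (2 + 4 * C) * t ^+ 2) = (2 + 5 / 2 * C) * t.
  by field; rewrite gt_eqF.
rewrite ler_wpM2r// ?(ltW t0)//; rewrite -/C in d0; glra.
Qed.

(** The sum telescopes: [growth k / k] decreases by exactly [(1 - th) growth k / (k (k+1))]. *)
Lemma growth_sum n :
  \sum_(1 <= k < n.+1) growth k / (k%:R * k.+1%:R) = (1 - growth n.+1 / n.+1%:R) / (1 - th).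
Proof.
elim: n => [|n IH].
  by rewrite big_geq//= invr0 mulr0 addr0 mulr1 divr1 subrr mul0r.
rewrite big_nat_recr// IH (growthS n.+1) -(natr1 n.+1).
have : n.+1%:R != 0 :> R by rewrite pnatr_eq0.
have : n.+1%:R + 1 != 0 :> R by rewrite natr1 pnatr_eq0.
have : 1 - th != 0 by rewrite subr_eq0 gt_eqF.
move: (growth n.+1) (n.+1%:R) => t x h1 h2 h3 /=; field; rewrite h1 h2 h3 //.
Qed.

End Growth.

(** * The second moment of the alternating sum *)

Section SecondMoment.
Variable rho : nat -> R.
Hypothesis rhoS : forall j, (0 < j)%N ->
  j%:R * rho j + (j%:R + q) * rho j.+1 = 1.

(* Correcting [E S^2] by the covariance with the walk turns the alternating
   double sum into a sum of nonnegative terms. *)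
Lemma Ex_altsum_sqr m n : (0 < m)%N -> (m <= n)%N ->
  Ex n (fun s => altsum m s ^+ 2) +
    2 * (-1) ^+ n * rho n * Ex n (fun s => altsum m s * walk s) =
  \sum_(m <= j < n) walk_var j / j%:R * (2 * rho j - j%:R^-1).
Proof.
move=> m0; elim: n => [|n IH]; first by rewrite leqn0; case: m m0.
rewrite leq_eqVlt => /predU1P[<-|].
  rewrite big_geq//.
  have z f : Ex m (fun s => altsum m s * f s) = 0.
    rewrite -[RHS](Ex_cst m); apply: eq_Ex => s sm.
    by rewrite altsum_size ?mul0r// sm.
  by rewrite (z walk) mulr0 addr0 (z (altsum m)).
rewrite ltnS => mn; rewrite big_nat_recr//= -(IH mn) {IH}.
have n0 : (0 < n)%N by exact: leq_trans mn.
have nR : n%:R != 0 :> R by rewrite pnatr_eq0 -lt0n.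
have ee : ((-1) ^+ n) ^+ 2 = 1 :> R by rewrite -exprM mulnC exprM sqrrN expr1n expr1n.
rewrite exprS; set e := (-1) ^+ n in ee *.
have -> : Ex n.+1 (fun s => altsum m s ^+ 2) =
    Ex n (fun s => altsum m s ^+ 2) +
    2 * e / n%:R * Ex n (fun s => altsum m s * walk s) + (n%:R ^- 2) * walk_var n.
  rewrite /walk_var -!ExZ -!ExD ExS_drift; apply: eq_Ex => s sn.
  rewrite !altsum_rcons ?sn// -/e.
  set A := altsum m s; set W := walk s.
  transitivity (A ^+ 2 + 2 * e / n%:R * (A * W) + e ^+ 2 * (n%:R ^- 2 * W ^+ 2)); first by field.
  by rewrite ee mul1r.
have -> : Ex n.+1 (fun s => altsum m s * walk s) =
    (1 + q / n%:R) * (Ex n (fun s => altsum m s * walk s) + e / n%:R * walk_var n).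
  rewrite /walk_var -!ExZ -!ExD -ExZ ExS_drift; apply: eq_Ex => s sn.
  rewrite !altsum_rcons ?sn// -/e !walk_rcons /sgb.
  set A := altsum m s; set W := walk s; by field.
have -> : (1 + q / n%:R) * (Ex n (fun s => altsum m s * walk s) + e / n%:R * walk_var n) =
  (n%:R + q) / n%:R * (Ex n (fun s => altsum m s * walk s) + e / n%:R * walk_var n).
  by field.
set x := Ex n (fun s => altsum m s * walk s); set y := Ex n _; set v := walk_var n.
(* Eliminating [rho n.+1] restores the coefficient [2 e rho n] of the covariance [x], so only the
   variance term is added at each step. *)
have r1 : (n%:R + q) * rho n.+1 = 1 - n%:R * rho n.
  by apply/esym/eqP; rewrite subr_eq addrC (rhoS n0).
transitivity (y + 2 * e / n%:R * x + n%:R ^- 2 * v -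
   2 * e / n%:R * ((n%:R + q) * rho n.+1) * x -
   2 * e ^+ 2 / n%:R ^+ 2 * ((n%:R + q) * rho n.+1) * v).
  by field.
by rewrite r1 ee; field.
Qed.

(** The covariance correction is split with a free weight [eta], so that only [rho^2 * walk_var] has
    to be shown to vanish. *)
Lemma Ex_altsum_sqr_near m n (eta : R) : (0 < m)%N -> (m <= n)%N -> 0 < eta ->
  `|\sum_(m <= j < n) walk_var j / j%:R * (2 * rho j - j%:R^-1) -
    Ex n (fun s => altsum m s ^+ 2)| <=
  eta * Ex n (fun s => altsum m s ^+ 2) + rho n ^+ 2 * walk_var n / eta.
Proof.
move=> m0 mn eta0; rewrite -(Ex_altsum_sqr m0 mn) addrAC subrr add0r.
have ee : ((-1) ^+ n) ^+ 2 = 1 :> R by rewrite -exprM mulnC exprM sqrrN expr1n expr1n.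
(* Taking [c = 1] and [c = -1] gives the two sides of the absolute value. *)
have h c : c ^+ 2 = 1 -> c * (2 * (-1) ^+ n * rho n * Ex n (fun s => altsum m s * walk s)) <=
    eta * Ex n (fun s => altsum m s ^+ 2) + rho n ^+ 2 * walk_var n / eta.
  move=> cc; rewrite mulrA (mulrAC _ _ eta^-1) /walk_var -!ExZ -ExD; apply: le_Ex => s _.
  set e := (-1) ^+ n in ee *; set A := altsum m s; set W := walk s; set r := rho n.
  rewrite -subr_ge0.
  have -> : eta * A ^+ 2 + r ^+ 2 / eta * W ^+ 2 - c * (2 * e * r) * (A * W) =
    eta^-1 * ((eta * A - c * e * r * W) ^+ 2 + (1 - c ^+ 2 * e ^+ 2) * (r * W) ^+ 2).
    by field; rewrite gt_eqF.
  by rewrite cc ee mulr1 subrr mul0r addr0 mulr_ge0 ?sqr_ge0// invr_ge0 ltW.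
rewrite ler_norml lerNl; apply/andP; split.
  by have := h (-1); rewrite mulN1r sqrrN expr1n; apply.
by have := h 1; rewrite mul1r expr1n; apply.
Qed.

End SecondMoment.

End Expectation.

(** * The limit of the second moments as an integral *)

Section LimitVariance.
Variables (R : realType) (p : R).
Hypotheses (hp0 : 0 <= p) (hp1 : p < 1).
Local Notation q := (2 * p - 1).
Local Notation mu := (@lebesgue_measure R).

Let q_ge : -1 <= q. Proof. by move: hp0; lra. Qed.
Let q_lt : q < 1. Proof. by move: hp1; lra. Qed.

(** The maximum with 1/2 treats all values of [q] at once, and [th] is the midpoint between [q1] and
    1. *)
Let q1 : R := Num.max q (1 / 2).
Let th : R := (1 + q1) / 2.

Let qq1 : q <= q1. Proof. by rewrite /q1 le_max lexx. Qed.
Let q1_ge : 1 / 2 <= q1. Proof. by rewrite /q1 le_max lexx orbT. Qed.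
Let q1_lt : q1 < 1. Proof. by rewrite /q1 gt_max; apply/andP; split; move: hp1; lra. Qed.
Let q1th : q1 < th. Proof. by rewrite /th; move: q1_lt; lra. Qed.
Let th1 : th < 1. Proof. by rewrite /th; move: q1_lt; lra. Qed.

Lemma growth_ge0 n : 0 <= growth th n.
Proof. exact: ltW (growth_gt0 q1_ge q1th n). Qed.

Lemma growth_le n : (0 < n)%N -> growth th n <= n%:R.
Proof.
have th0 : 0 <= th by move: q1_ge q1th; lra.
case: n => // n _; elim: n => [|n IH]; first by rewrite growthS invr0 mulr0 addr0 mulr1.
rewrite growthS; have n0 : 0 < n.+1%:R :> R by rewrite ltr0n.
apply: (@le_trans _ _ (n.+1%:R * (1 + th / n.+1%:R))).
  by rewrite ler_wpM2r// addr_ge0// divr_ge0// ltW.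
have -> : n.+1%:R * (1 + th / n.+1%:R) = n.+1%:R + th.
  by move: (n.+1%:R) n0 => x x0; field; rewrite gt_eqF.
by rewrite -(natr1 n.+1) lerD2l ltW.
Qed.

Lemma growth_sum_le n :
  \sum_(1 <= k < n) growth th k / (k%:R * k.+1%:R) <= (1 - th)^-1.
Proof.
case: n => [|n]; first by rewrite big_geq// invr_ge0 subr_ge0 ltW.
rewrite (growth_sum th1) -[leRHS]mul1r ler_wpM2r ?invr_ge0 ?subr_ge0 ?(ltW th1)//.
by rewrite gerBl divr_ge0// growth_ge0.
Qed.

Lemma cvg_growth_div : growth th n / n%:R @[n --> \oo] --> 0.
Proof.
have th0 : 0 <= th by move: q1_ge q1th; lra.
apply: (bounded_increments_cvg0 (c := 1) (M := (1 - th)^-1)) => // n.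
  rewrite growthS mulrDr mulr1 addrAC subrr add0r ger0_norm; last first.
    by rewrite mulr_ge0 ?growth_ge0// divr_ge0.
  have [->|n0] := posnP n; first by rewrite invr0 !mulr0.
  rewrite mulrCA; apply: mulr_ile1 => //; rewrite ?(ltW th1) ?(divr_ge0 (growth_ge0 n))//.
  by rewrite ler_pdivrMr ?ltr0n// mul1r growth_le.
apply: le_trans (growth_sum_le n); apply: ler_sum_nat => k _.
by rewrite ger0_norm// growth_ge0.
Qed.

Let y (j : nat) : R := walk_var p j / j%:R.
Let F (j : nat) : R := phi_moment q j.

Let y_ge0 j : 0 <= y j.
Proof. by rewrite divr_ge0// walk_var_ge0. Qed.

Let y_le j : y j <= j%:R.
Proof.
have [->|j0] := posnP j; first by rewrite /y invr0 mulr0.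
rewrite /y ler_pdivrMr ?ltr0n// -expr2 -[leRHS](Ex_cst p j).
apply: le_Ex => // s sj; rewrite -[leLHS]real_normK ?num_real// -sj.
by rewrite lerXn2r ?nnegrE// walk_le.
Qed.

Let y1 : y 1 = 1. Proof. by rewrite /y walk_var1 divr1. Qed.

Let yS j : (0 < j)%N -> j.+1%:R * y j.+1 = 1 + (j%:R + 2 * q) * y j.
Proof.
move=> j0; rewrite /y mulrC divfK ?pnatr_eq0// walk_varS.
have : j%:R != 0 :> R by rewrite pnatr_eq0 -lt0n.
by move: (j%:R) (walk_var p j) => a b a0; field.
Qed.

Let yF_ge0 j : 0 <= y j * F j.
Proof. by rewrite mulr_ge0// phi_moment_ge0. Qed.

Let M : R := 3 * (th - q1)^-1 * (1 - th)^-1.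

(** In [walk_var j <= C growth^2], one factor [growth] is absorbed by the division by [j]; the other
    is summed by [growth_sum_le]. *)
Let yF_sum_le N : \sum_(1 <= j < N) y j * F j <= M.
Proof.
have C0 : 0 <= (th - q1)^-1 by rewrite invr_ge0 subr_ge0 ltW.
apply: (@le_trans _ _ (3 * (th - q1)^-1 *
  \sum_(1 <= k < N) growth th k / (k%:R * k.+1%:R))); last first.
  by rewrite ler_wpM2l ?growth_sum_le// mulr_ge0.
rewrite mulr_sumr; apply: ler_sum_nat => j /andP[j0 _].
have jR : 0 < j%:R :> R by rewrite ltr0n.
apply: (@le_trans _ _ (y j * (3 / (j%:R * j.+1%:R)))).
  by rewrite ler_wpM2l// phi_moment_le.
have -> : y j * (3 / (j%:R * j.+1%:R)) = 3 * y j / (j%:R * j.+1%:R) by ring.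
rewrite [leRHS]mulrA ler_wpM2r ?invr_ge0 ?mulr_ge0// -[leRHS]mulrA ler_wpM2l//.
rewrite ler_pdivrMr// (le_trans (walk_var_le hp0 hp1 qq1 q1_ge q1th th1 j))//.
by rewrite expr2 -!mulrA !ler_wpM2l ?growth_ge0// growth_le.
Qed.

Let w (n : nat) : R := rho q n ^+ 2 * walk_var p n.

Let w_ge0 n : 0 <= w n.
Proof. by rewrite mulr_ge0 ?sqr_ge0// walk_var_ge0. Qed.

(** Since [phi_moment n <= 3/n], [rho n <= 2/n]; hence [w n] is at most a multiple of
    [(growth n / n)^2]. *)
Let cvg_w : w n @[n --> \oo] --> 0.
Proof.
have C0 : 0 <= (th - q1)^-1 by rewrite invr_ge0 subr_ge0 ltW.
have lim0 : 4 * (th - q1)^-1 * (growth th n / n%:R * (growth th n / n%:R)) @[n --> \oo] --> 0.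
  have h := cvgMr (a := 4 * (th - q1)^-1) (cvgM cvg_growth_div cvg_growth_div).
  by rewrite !mulr0 in h; exact: h.
apply: (@squeeze_cvgr _ _ _ _ (fun=> 0)
  (fun n => 4 * (th - q1)^-1 * (growth th n / n%:R * (growth th n / n%:R))));
  [|exact: cvg_cst|exact: lim0].
near=> n; rewrite w_ge0 /=.
have n0 : (0 < n)%N by near: n; exact: nbhs_infty_gt.
have nR : 0 < n%:R :> R by rewrite ltr0n.
have r0 : 0 <= rho q n by rewrite /rho divr_ge0// addr_ge0 ?phi_moment_ge0// invr_ge0 ltW.
have r1 : rho q n <= 2 / n%:R.
  rewrite /rho ler_pdivrMr//.
  apply: (@le_trans _ _ (3 / n%:R + n%:R^-1)); last by lra.
  rewrite lerD2r (le_trans (phi_moment_le q_ge n0))//.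
  rewrite ler_wpM2l// lef_pV2 ?posrE ?mulr_gt0 ?ltr0n// ler_peMr ?(ltW nR)//.
  by rewrite ler1n.
apply: (@le_trans _ _ ((2 / n%:R) ^+ 2 * ((th - q1)^-1 * growth th n ^+ 2))).
  apply: ler_pM; first exact: sqr_ge0.
  - exact: walk_var_ge0.
  - by apply: lerXn2r; rewrite ?nnegrE ?r0 ?r1// divr_ge0.
  exact: (walk_var_le hp0 hp1 qq1 q1_ge q1th th1 n).
rewrite le_eqVlt; apply/orP; left; apply/eqP.
by move: ((th - q1)^-1) (growth th n) => a b; field; rewrite gt_eqF.
Unshelve. all: by end_near. Qed.

Let rhoF j : 2 * rho q j - j%:R^-1 = F j.
Proof. by rewrite /rho /F; lra. Qed.

Let near_sum m n eta : (0 < m)%N -> (m <= n)%N -> 0 < eta ->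
  `|\sum_(m <= j < n) y j * F j - Ex p n (fun s => altsum m s ^+ 2)| <=
  eta * Ex p n (fun s => altsum m s ^+ 2) + w n / eta.
Proof.
move=> m0 mn e0.
have := Ex_altsum_sqr_near hp0 hp1 (@rho_recurrence _ _) m0 mn e0.
by under eq_bigr do rewrite rhoF.
Qed.

(** With [eta = 1/2], half of the second moment is absorbed into the left-hand side. *)
Let sqr_le m n : (0 < m)%N -> (m <= n)%N ->
  Ex p n (fun s => altsum m s ^+ 2) <= 2 * \sum_(m <= j < n) y j * F j + 4 * w n.
Proof.
move=> m0 mn; have e0 : 0 < 1 / 2 :> R by lra.
have := near_sum m0 mn e0; rewrite ler_norml => /andP[+ _].
rewrite invf_div divr1; set a := \sum_(_ <= _ < _) _; set b := Ex _ _ _; lra.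
Qed.

Lemma Ex_altsum_tail e : 0 < e -> exists2 m0, (0 < m0)%N &
  forall m n, (m0 <= m)%N -> (m <= n)%N -> Ex p n (fun s => altsum m s ^+ 2) <= e.
Proof.
move=> e0; have e4 : 0 < e / 4 by rewrite divr_gt0.
have [m1 m10 h1] := bounded_sum_tail yF_ge0 yF_sum_le e4.
(* In [sqr_le] the tail then costs [2 * e/4] and the correction [4 * e/8]. *)
have e8 : 0 < e / 8 by rewrite divr_gt0.
have /cvgrPdist_le /(_ _ e8) [m2 _ h2] := cvg_w.
exists (maxn m1 m2) => [|m n]; first by rewrite leq_max m10.
rewrite geq_max => /andP[m1m m2m] mn.
have m0 : (0 < m)%N by exact: leq_trans m1m.
apply: le_trans (sqr_le m0 mn) _.
have k1 : \sum_(m <= j < n) y j * F j <= e / 4.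
  apply: le_trans (h1 n); rewrite [leRHS](big_cat_nat (n := m))//= lerDr.
  by rewrite sumr_ge0.
have k2 : w n <= e / 8.
  have := h2 n (leq_trans m2m mn).
  by rewrite sub0r normrN ger0_norm.
lra.
Qed.

Lemma cvg_Ex_altsum (K : R -> R) :
  (forall u, 0 < u < 1 -> \sum_(1 <= j < N) y j * (1 - u) ^+ j.-1 * phi q u @[N --> \oo] --> K u) ->
  mu.-integrable `[0, 1] (EFin \o K) /\
  Ex p n (fun s => altsum 1 s ^+ 2) @[n --> \oo] --> \int[mu]_(u in `[0, 1]) K u.
Proof.
move=> hK; have [iK cK] := cvg_phi_moment_series q_lt y_ge0 yF_sum_le hK.
split=> //.
have M0 : 0 <= M by rewrite (le_trans _ (yF_sum_le 0))// big_geq.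
suff d0 : \sum_(1 <= j < n) y j * F j - Ex p n (fun s => altsum 1 s ^+ 2) @[n --> \oo] --> 0.
  have h := cvgB cK d0; rewrite subr0 in h.
  have -> : (fun n => Ex p n (fun s => altsum 1 s ^+ 2)) =
      (fun n => \sum_(1 <= j < n) y j * F j -
        (\sum_(1 <= j < n) y j * F j - Ex p n (fun s => altsum 1 s ^+ 2))).
    by apply/funext => n; rewrite subKr.
  exact: h.
apply/cvgrPdist_le => e e0.
(* By [sqr_le], [B] bounds the second moment as soon as [w n <= 1]. With [eta = e / (2 B)] each of
   the two error terms is at most [e / 2]. *)
pose B := 2 * M + 4.
have B0 : 0 < B by rewrite /B; lra.
have eta0 : 0 < e / (2 * B) by rewrite divr_gt0// mulr_gt0.
have d0 : 0 < e / 2 * (e / (2 * B)) by rewrite mulr_gt0// divr_gt0.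
near=> n.
have n1 : (1 <= n)%N by near: n; exact: nbhs_infty_gt.
have w1 : w n <= 1.
  rewrite -[leLHS]ger0_norm// -[w n]subr0 distrC; near: n.
  by move/cvgrPdist_le : cvg_w; apply.
have w2 : w n <= e / 2 * (e / (2 * B)).
  rewrite -[leLHS]ger0_norm// -[w n]subr0 distrC; near: n.
  by move/cvgrPdist_le : cvg_w; apply.
rewrite sub0r normrN; apply: le_trans (near_sum _ n1 eta0) _ => //.
have sB : Ex p n (fun s => altsum 1 s ^+ 2) <= B.
  apply: le_trans (sqr_le _ n1) _ => //.
  by have := yF_sum_le n; rewrite /B; lra.
apply: (@le_trans _ _ (e / (2 * B) * B + e / 2)); last first.
  by rewrite le_eqVlt; apply/orP; left; apply/eqP; field; rewrite gt_eqF.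
apply: lerD; first by rewrite ler_wpM2l// ltW.
by rewrite ler_pdivrMr.
Unshelve. all: by end_near. Qed.

(** Keeping the primitive [g] abstract covers its power form and its logarithmic form together. *)
Let cvg_series_of (g : R -> R) u : 0 < u < 1 -> g 0 = 0 ->
  (forall t : R, t < 1 -> is_derive t 1 g ((1 - t) `^ (2 * q - 2))) ->
  \sum_(1 <= j < N) y j * (1 - u) ^+ j.-1 * phi q u @[N --> \oo] -->
  u `^ (- (2 * q)) * g (1 - u) * (phi q u / (1 - u)).
Proof.
move=> /andP[u0 u1] g0 dg.
have s01 : 0 < 1 - u < 1 by apply/andP; split; lra.
have h := cvgMl (b := phi q u / (1 - u))
  (cvg_generating_series q_lt y1 yS y_ge0 y_le q_ge s01 g0 dg).
rewrite subKr in h.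
have -> : (fun N => \sum_(1 <= j < N) y j * (1 - u) ^+ j.-1 * phi q u) =
    (fun N => (\sum_(1 <= j < N) y j * (1 - u) ^+ j) * (phi q u / (1 - u))).
  apply/funext => N; rewrite mulr_suml; apply: eq_big_nat => -[|j] // _.
  have : 1 - u != 0 by rewrite subr_eq0 gt_eqF.
  by rewrite exprS /=; move: (1 - u) (_ ^+ j) => a b a0; field.
exact: h.
Qed.

Lemma cvg_Ex_altsum_neq : q != 1 / 2 ->
  Ex p n (fun s => altsum 1 s ^+ 2) @[n --> \oo] -->
  (2 * q - 1)^-1 * \int[mu]_(u in `[0, 1]) ((u `^ (- 2 * q + 1) - 1) / (1 - u) *
                       (((1 - u / 2) `^ (q - 1) - 1) / u)).
Proof.
move=> q2; have c0 : 2 * q - 1 != 0.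
  by apply: contra q2 => /eqP h; apply/eqP; lra.
pose I u : R := (u `^ (- 2 * q + 1) - 1) / (1 - u) * (((1 - u / 2) `^ (q - 1) - 1) / u).
pose K u : R := (2 * q - 1)^-1 * I u.
have [|iK cK] := @cvg_Ex_altsum K.
  move=> u u01; have /andP[u0 u1] := u01.
  (* The primitive of [(1 - t)^(2q-2)] vanishing at 0, which exists as a power because [2q - 1] is
     nonzero. *)
  pose g (t : R) : R := (1 - (1 - t) `^ (2 * q - 1)) / (2 * q - 1).
  have -> : K u = u `^ (- (2 * q)) * g (1 - u) * (phi q u / (1 - u)).
    rewrite /K /I /g /phi subKr.
    have -> : u `^ (- 2 * q + 1) = u `^ (- (2 * q)) * u.
      rewrite -[in X in _ = _ * X](powRr1 (ltW u0)) -powRD ?(gt_eqF u0) ?implybT//.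
      by rewrite mulNr.
    have e1 : u `^ (- (2 * q)) * u `^ (2 * q - 1) = u^-1.
      rewrite -powRD ?(gt_eqF u0) ?implybT//.
      have -> : - (2 * q) + (2 * q - 1) = -1 by ring.
      by rewrite powR_inv1// ltW.
    have d0 : 1 - u != 0 by rewrite subr_eq0 gt_eqF.
    transitivity ((u `^ (- (2 * q)) - u `^ (- (2 * q)) * u `^ (2 * q - 1)) / (2 * q - 1) *
      (((1 - u / 2) `^ (q - 1) - 1) / (1 - u))); last by ring.
    rewrite e1.
    by move: (2 * q - 1) c0 => c c0; field; rewrite c0 d0 gt_eqF.
  apply: cvg_series_of => //; first by rewrite /g subr0 powR1 subrr mul0r.
  move=> t t1; have x0 : 0 < 1 - t by rewrite subr_gt0.
  have D := @is_derive1_comp _ (fun z : R => z `^ (2 * q - 1)) (fun x : R => 1 - x) t _ _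
     (is_derive1_powR (2 * q - 1) x0) (is_derive_onem t).
  have -> : g = (fun t => (2 * q - 1)^-1 * (cst 1 t - (1 - t) `^ (2 * q - 1))).
    by apply/funext => z; rewrite /g mulrC.
  apply: (is_derive_eq (is_derive_mulC (2 * q - 1)^-1
    (is_deriveB (is_derive_cst (1 : R) t (1 : R)) D))).
  have -> : 2 * q - 1 - 1 = 2 * q - 2 by ring.
  by move: (2 * q - 1) c0 (_ `^ _) => c c0 P; field.
(* Integrability is known for [K]; it is carried over to [I] before the constant can leave the
   integral. *)
have iI : mu.-integrable `[0, 1] (EFin \o I).
  have -> : EFin \o I = (fun u => (2 * q - 1)%:E * (EFin \o K) u)%E.
    by apply/funext => u; rewrite /K /= -EFinM mulrA divff ?mul1r.
  exact: integrableZl.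
by move: cK; rewrite RintegralZl.
Qed.

Lemma cvg_Ex_altsum_eq : q = 1 / 2 ->
  Ex p n (fun s => altsum 1 s ^+ 2) @[n --> \oo] -->
  \int[mu]_(u in `[0, 1]) ((- ln u) / (1 - u) *
                       (((1 - u / 2) `^ (- (1 / 2)) - 1) / u)).
Proof.
move=> q2; apply: (cvg_Ex_altsum _).2 => u u01; have /andP[u0 u1] := u01.
pose g (t : R) : R := - ln (1 - t).
have -> : (- ln u) / (1 - u) * (((1 - u / 2) `^ (- (1 / 2)) - 1) / u) =
    u `^ (- (2 * q)) * g (1 - u) * (phi q u / (1 - u)).
  rewrite /g /phi subKr.
  have -> : - (2 * q) = -1 by rewrite q2; lra.
  have -> : q - 1 = - (1 / 2) by rewrite q2; lra.
  by rewrite powR_inv1 ?(ltW u0)//; ring.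
apply: cvg_series_of => //; first by rewrite /g subr0 ln1 oppr0.
move=> t t1; have x0 : 0 < 1 - t by rewrite subr_gt0.
have D := @is_derive1_comp _ (@ln R) (fun x : R => 1 - x) t _ _
  (is_derive1_ln x0) (is_derive_onem t).
apply: (is_derive_eq (is_deriveN D)).
have -> : 2 * q - 2 = -1 by rewrite q2; lra.
by rewrite powR_inv1 ?(ltW x0)//; ring.
Qed.

Lemma Ex_norm_sum_le : exists M : R, forall n,
  \sum_(1 <= k < n) Ex p k (fun s => `|walk s| + `|location s|) / (k%:R * k.+1%:R) <= M.
Proof.
have [K [K0 hK]] := Ex_norm_le hp0 hp1 qq1 q1_ge q1th th1.
exists (K * (1 - th)^-1) => n.
apply: (@le_trans _ _ (K * \sum_(1 <= k < n) growth th k / (k%:R * k.+1%:R))); last first.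
  by rewrite ler_wpM2l// growth_sum_le.
rewrite mulr_sumr; apply: ler_sum_nat => k _.
by rewrite mulrA ler_wpM2r// invr_ge0 mulr_ge0.
Qed.

End LimitVariance.

(** * Random variables depending on finitely many steps *)

Section StepMeasure.
Variables (R : realType) (d : measure_display) (T : measurableType d).
Variables (P : probability T R) (g : nat -> T -> bool) (p : R).
Hypotheses (hp0 : 0 <= p) (hp1 : p < 1).
Hypothesis hgmeas : forall n, measurable [set x | g n x].
Hypothesis hlaw : forall s : seq bool,
  P [set x | steps g (size s) x = s] = (erw_prob p s)%:E.
Implicit Types (s : seq bool) (f h : seq bool -> R).

Lemma size_steps n x : size (steps g n x) = n.
Proof. by rewrite /steps size_map size_iota. Qed.

Lemma stepsS n x : steps g n.+1 x = rcons (steps g n x) (g n.+1 x).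
Proof. by rewrite /steps -[in LHS]addn1 iotaD map_cat /= cats1. Qed.

Lemma take_steps k n x : (k <= n)%N -> take k (steps g n x) = steps g k x.
Proof. by move=> kn; rewrite /steps -map_take take_iota (minn_idPl kn). Qed.

Lemma measurable_steps n s : measurable [set x | steps g n x = s].
Proof.
elim: n s => [|n IH] s.
  have [->|s0] := eqVneq s [::].
    have -> : [set x | steps g 0 x = [::]] = setT by apply/seteqP; split.
    exact: measurableT.
  have -> : [set x | steps g 0 x = s] = set0.
    by apply/seteqP; split => // x /= e; rewrite -e in s0.
  exact: measurable0.
case/lastP: s => [|s b].
  have -> : [set x | steps g n.+1 x = [::]] = set0 by apply/seteqP; split.
  exact: measurable0.
have -> : [set x | steps g n.+1 x = rcons s b] = [set x | steps g n x = s] `&`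
    (if b then [set x | g n.+1 x] else ~` [set x | g n.+1 x]).
  rewrite /mkset; apply/seteqP; split => x; rewrite stepsS.
    by move=> /rcons_inj[e1 e2]; split; [exact: e1|case: b e2 => /= ->].
  move=> [e1 gb]; rewrite (e1 : steps g n x = s); congr rcons.
  by case: b gb => /= [->//|/negP/negbTE ->].
by apply: measurableI => //; case: b; [|apply: measurableC].
Qed.

Let atom s : set T := [set x | steps g (size s) x = s].

(** A function of the first [n] steps is a finite combination of indicators of atoms, so [hlaw]
    determines its integral. *)
Lemma steps_sumE n f x :
  f (steps g n x) = \sum_(s <- words n) f s * \1_(atom s) x.
Proof.
have sx : steps g n x \in words n by rewrite mem_words size_steps.
rewrite (big_rem _ sx)/= big_seq big1 ?addr0.
  by rewrite indicE mem_set ?mulr1// /atom /= size_steps.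
move=> s; rewrite mem_rem_uniq ?words_uniq// inE mem_words => /andP[sx' /eqP sn].
rewrite indicE memNset ?mulr0// /atom /= sn => e.
by rewrite e eqxx in sx'.
Qed.

Let sum_atoms (l : seq (seq bool)) f :
  P.-integrable setT (EFin \o (fun x => \sum_(s <- l) f s * \1_(atom s) x)) /\
  \int[P]_x (\sum_(s <- l) f s * \1_(atom s) x) = \sum_(s <- l) erw_prob p s * f s.
Proof.
elim: l => [|s l [IHi IH]].
  have -> : (fun x => \sum_(s <- [::]) f s * \1_(atom s) x) = cst 0.
    by apply/funext => x; rewrite big_nil.
  by rewrite big_nil Rintegral_cst// mul0r; split => //; exact: integrable0.
have i1 : P.-integrable setT (EFin \o (\1_(atom s) : T -> R)).
  by apply: integrable_indic; exact: measurable_steps.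
have i2 : P.-integrable setT (EFin \o (fun x => f s * \1_(atom s) x)).
  have -> : EFin \o (fun x => f s * \1_(atom s) x) =
      (fun x => (f s)%:E * (EFin \o (\1_(atom s) : T -> R)) x)%E by [].
  exact: integrableZl.
have -> : (fun x => \sum_(s <- s :: l) f s * \1_(atom s) x) =
    (fun x => f s * \1_(atom s) x + \sum_(s <- l) f s * \1_(atom s) x).
  by apply/funext => x; rewrite big_cons.
split; first exact: integrableD i2 IHi.
rewrite RintegralD// IH big_cons RintegralZl//; congr (_ + _).
rewrite /Rintegral integral_indic ?setIT//; last exact: measurable_steps.
by rewrite mulrC; congr (_ * _); exact: congr1 (hlaw s).
Qed.

Lemma integrable_steps n f : P.-integrable setT (EFin \o (fun x => f (steps g n x))).
Proof.
have [+ _] := sum_atoms (words n) f; congr (P.-integrable setT (EFin \o _)).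
by apply/funext => x; rewrite (steps_sumE n f).
Qed.

Lemma Rintegral_steps n f : \int[P]_x f (steps g n x) = Ex p n f.
Proof.
rewrite /Ex; have [_ <-] := sum_atoms (words n) f.
by apply: eq_Rintegral => x _; exact: steps_sumE.
Qed.

Lemma measurable_fun_steps n f : measurable_fun setT (fun x => f (steps g n x)).
Proof. by apply/measurable_EFinP; exact: measurable_int (integrable_steps n f). Qed.

Lemma integral_steps n f : (\int[P]_x (f (steps g n x))%:E)%E = (Ex p n f)%:E.
Proof.
rewrite -Rintegral_steps /Rintegral fineK//.
by apply: integrable_fin_num => //; exact: integrable_steps.
Qed.

(** Only the two one-letter extensions of the current word survive in the numerator. On an atom of
    probability 0, which can occur for [p = 0], [cexp] would divide by 0. *)
Lemma cexp_steps n h x : erw_prob p (steps g n x) != 0 ->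
  cexp P g n (fun y => h (steps g n.+1 y)) x =
  step_prob p (steps g n x) true * h (rcons (steps g n x) true) +
  step_prob p (steps g n x) false * h (rcons (steps g n x) false).
Proof.
move=> e0; rewrite /cexp; set s := steps g n x in e0 *.
have sn : size s = n by rewrite size_steps.
have -> : P [set y | steps g n y = s] = (erw_prob p s)%:E by rewrite -hlaw sn.
have -> : \int[P]_y (h (steps g n.+1 y) * (steps g n y == s)%:R) =
    Ex p n.+1 (fun t => h t * (take n t == s)%:R).
  by rewrite -Rintegral_steps; apply: eq_Rintegral => y _; rewrite take_steps.
rewrite ExS /Ex (big_rem s)/=; last by rewrite mem_words sn.
rewrite big_seq big1 ?addr0.
  by rewrite -!cats1 !take_size_cat// eqxx !mulr1 mulrC mulKf.
move=> t; rewrite mem_rem_uniq ?words_uniq// inE mem_words => /andP[ts /eqP tn].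
by rewrite -!cats1 !take_size_cat// (negbTE ts) !mulr0 addr0 mulr0.
Qed.

(** The expected indicator of a word of probability 0 is a sum of zero terms; countably many lengths
    are then combined. *)
Lemma erw_prob_steps_neq0 : {ae P, forall x, forall n, erw_prob p (steps g n x) != 0}.
Proof.
apply: ae_foralln => n; pose A := [set x | erw_prob p (steps g n x) == 0].
have AE : \1_A = (fun x => (erw_prob p (steps g n x) == 0)%:R) :> (T -> R).
  apply/funext => x; rewrite indicE.
  by have [e|/negP e] := boolP (erw_prob p (steps g n x) == 0); [rewrite mem_set|rewrite memNset].
have mA : measurable A.
  have := measurable_fun_steps n (fun s => (erw_prob p s == 0)%:R).
  move=> /(_ measurableT [set 1] (measurable_set1 1)); rewrite setTI.
  congr measurable; apply/seteqP; split => x /=; rewrite /A /=.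
    by case: eqP => // _ /eqP; rewrite eq_sym oner_eq0.
  by move=> ->.
have A0 : P A = 0%E.
  rewrite -[A]setIT -integral_indic// AE.
  rewrite (integral_steps n (fun s => (erw_prob p s == 0)%:R)); congr EFin.
  by rewrite /Ex big1// => s _; case: eqP => [->|_]; rewrite ?mul0r ?mulr0.
by exists A; split => // x /= /negP; rewrite negbK.
Qed.

End StepMeasure.

(** * The limit of the predictable part *)

Section Limit.
Variables (R : realType) (d : measure_display) (T : measurableType d).
Variables (P : probability T R) (g : nat -> T -> bool) (p : R).
Hypotheses (hp0 : 0 <= p) (hp1 : p < 1).
Hypothesis hgmeas : forall n, measurable [set x | g n x].
Hypothesis hlaw : forall s : seq bool,
  P [set x | steps g (size s) x = s] = (erw_prob p s)%:E.
Local Notation q := (2 * p - 1).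
Local Notation st := (steps g).

Let int_steps n f := integral_steps hgmeas hlaw n f.
Let meas_steps n f : measurable_fun setT (fun x => f (st n x)) :=
  measurable_fun_steps hgmeas hlaw n f.

(** By Tonelli the series of nonnegative terms has finite expectation, hence is finite almost
    everywhere, and its value is the bound. *)
Lemma ae_bounded_sum : {ae P, forall x, exists M : R, forall n,
  \sum_(1 <= k < n) ((`|walk (st k x)| + `|location (st k x)|) / (k%:R * k.+1%:R)) <= M}.
Proof.
pose f k s : R := (`|walk s| + `|location s|) / (k%:R * k.+1%:R).
pose h k (x : T) : \bar R := (f k (st k x))%:E.
have f_ge0 k s : 0 <= f k s by rewrite /f divr_ge0 ?addr_ge0 ?mulr_ge0.
have mh k : measurable_fun setT (h k) by apply/measurable_EFinP; exact: meas_steps.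
have h0 k x : setT x -> (0 <= h k x)%E by move=> _; rewrite lee_fin.
have [M hM] := Ex_norm_sum_le hp0 hp1.
have S_int : P.-integrable setT (fun x => \sum_(k <oo) h k x)%E.
  apply/integrableP; split.
    apply: ge0_emeasurable_sum => // k x _ _; exact: h0.
  rewrite (eq_integral (fun x => \sum_(k <oo) h k x)%E); last first.
    by move=> x _; rewrite gee0_abs// nneseries_ge0// => k _ _; exact: h0.
  rewrite integral_nneseries//; apply: (@le_lt_trans _ _ M%:E); last exact: ltry.
  apply: lime_le; first by apply: is_cvg_nneseries => k _ _; apply: integral_ge0 => x; exact: h0.
  apply: nearW => n; rewrite (eq_bigr (fun k => (Ex p k (f k))%:E)); last first.
    by move=> k _; rewrite /h int_steps.
  rewrite sumEFin lee_fin; apply: le_trans (hM n).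
  case: n => [|n]; first by rewrite !big_geq.
  (* The term of index 0 is 0 by the convention on the inverse of 0, so the series may start
     there. *)
  rewrite big_ltn// [Ex p 0 _](_ : _ = 0) ?add0r; last first.
    by rewrite /Ex big_seq1 /f mul0r invr0 !mulr0.
  apply: ler_sum_nat => k _.
  rewrite le_eqVlt; apply/orP; left; apply/eqP.
  by rewrite mulrC -ExZ; apply: eq_Ex => s _; rewrite mulrC.
have := integrable_ae measurableT S_int.
apply: filterS => x /(_ Logic.I) fin; exists (fine (\sum_(k <oo) h k x)%E) => n.
rewrite -lee_fin fineK// -sumEFin.
have ge : (\sum_(0 <= k < n) h k x <= \sum_(k <oo) h k x)%E.
  by apply: nneseries_lim_ge => k *; exact: (h0 k x Logic.I).
apply: le_trans ge.
case: n => [|n]; first by rewrite !big_geq.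
by rewrite [leRHS]big_ltn// leeDr// (h0 _ x Logic.I).
Qed.

Lemma ae_cvg : {ae P, forall x,
  walk (st n x) / n%:R @[n --> \oo] --> (0 : R) /\
  cvgn (fun n => altsum 1 (st n x) : R)}.
Proof.
apply: filterS ae_bounded_sum => x [M hM].
have W0 : walk (st 0 x) = 0 :> R by exact: walk_nil.
have D0 : location (st 0 x) = 0 :> R by exact: location_nil.
have Winc n : `|walk (st n.+1 x) - walk (st n x)| <= 1 :> R.
  rewrite stepsS walk_rcons addrAC subrr add0r /sgb.
  by case: (g _ _); rewrite ?normrN normr1.
have Dinc n : location (st n.+1 x) - location (st n x) =
    (-1) ^+ n * (walk (st n.+1 x) - walk (st n x)) :> R.
  rewrite stepsS location_rcons walk_rcons size_steps.
  by rewrite addrAC subrr add0r addrAC subrr add0r.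
split; first exact: (cvg_walk_div Winc hM).
have -> : (fun n => altsum 1 (st n x) : R) =
    (fun n => \sum_(1 <= k < n) (-1) ^+ k * walk (st k x) / k%:R).
  apply/funext => n; rewrite /altsum size_steps.
  by apply: eq_big_nat => k /andP[_ kn]; rewrite take_steps// ltnW.
exact: is_cvg_altsum W0 D0 Winc Dinc hM.
Qed.

(** The upper limit is defined and measurable everywhere, so no exceptional null set has to be
    removed. *)
Definition limit_altsum (x : T) : R :=
  fine (limn_esup (fun n => (altsum 1 (st n x) : R)%:E)).

Lemma measurable_limit_altsum : measurable_fun setT limit_altsum.
Proof.
apply: (@measurableT_comp _ _ _ _ _ _ fine) => //.
apply: measurable_fun_limn_esup => n; apply/measurable_EFinP.
exact: meas_steps.
Qed.

Lemma ae_cvg_limit_altsum : {ae P, forall x,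
  altsum 1 (st n x) @[n --> \oo] --> limit_altsum x}.
Proof.
apply: filterS ae_cvg => x [_ /cvg_ex[/= l hl]].
suff -> : limit_altsum x = l by [].
have hl' : (altsum 1 (st n x))%:E @[n --> \oo] --> l%:E.
  by apply: cvg_EFin; [exact: nearW|exact: hl].
by rewrite /limit_altsum (cvg_limn_einf_sup hl').2.
Qed.

Lemma altsum_steps_sub m n x : (0 < m)%N -> (m <= n)%N ->
  altsum 1 (st n x) - altsum 1 (st m x) = altsum m (st n x) :> R.
Proof.
move=> m0 mn; rewrite /altsum !size_steps (big_cat_nat (n := m))//= addrAC.
rewrite [X in X - _](_ : _ = \sum_(1 <= k < m) (-1) ^+ k * walk (take k (st m x)) / k%:R).
  by rewrite subrr add0r.
apply: eq_big_nat => k /andP[_ km].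
by rewrite !take_steps// ltnW// (leq_trans km).
Qed.

Lemma limn_einf_le (u : nat -> \bar R) (l : \bar R) :
  (forall n, (u n <= l)%E) -> (limn_einf u <= l)%E.
Proof.
move=> ul; rewrite limn_einf_lim; apply: lime_le; first exact: is_cvg_einfs.
apply: nearW => n; apply: le_trans (ul n).
by apply: ereal_inf_lbound; exists n => /=.
Qed.

(** Extended-real valued, because square integrability of the limit is deduced from its
    finiteness. *)
Definition sqr_dist (n : nat) : \bar R :=
  (\int[P]_x ((altsum 1 (st n x) - limit_altsum x) ^+ 2)%:E)%E.

Let measurable_diff n : measurable_fun setT (fun x => altsum 1 (st n x) - limit_altsum x).
Proof. by apply: measurable_funB; [exact: meas_steps|exact: measurable_limit_altsum]. Qed.

(** Fatou's lemma is applied to [(S_m - S_(n+m))^2] as [n] grows; the shift by [m] keeps the later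
    index at least [m], where [Ex_altsum_tail] applies. *)
Lemma sqr_dist_le (e : R) : 0 < e -> exists2 m0, (0 < m0)%N &
  forall m, (m0 <= m)%N -> (sqr_dist m <= e%:E)%E.
Proof.
move=> e0; have [m0 m00 hm0] := Ex_altsum_tail hp0 hp1 e0; exists m0 => // m m0m.
have m_gt0 : (0 < m)%N by exact: leq_trans m0m.
pose f n x : \bar R := ((altsum 1 (st m x) - altsum 1 (st (n + m) x)) ^+ 2)%:E.
have mf n : measurable_fun setT (f n).
  apply/measurable_EFinP; apply: measurable_funX.
  by apply: measurable_funB; exact: meas_steps.
have f0 n x : setT x -> (0 <= f n x)%E by move=> _; rewrite lee_fin sqr_ge0.
rewrite /sqr_dist (@ae_eq_integral _ _ _ P setT (fun x => limn_einf (f ^~ x)))//.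
- apply: le_trans (fatou P measurableT mf f0) _.
  apply: limn_einf_le => n.
  have -> : (\int[P]_x f n x = (Ex p (n + m) (fun s => altsum m s ^+ 2))%:E)%E.
    rewrite -int_steps; apply: eq_integral => x _; rewrite /f -opprB sqrrN.
    by rewrite altsum_steps_sub// leq_addl.
  by rewrite lee_fin hm0// leq_addl.
- by apply/measurable_EFinP; apply: measurable_funX; exact: measurable_diff.
- apply: (@measurableT_comp _ _ _ _ _ _ -%E) => //.
  by apply: measurable_fun_limn_esup => n; apply: (@measurableT_comp _ _ _ _ _ _ -%E).
apply: filterS ae_cvg_limit_altsum => x hx _.
have cvgf : f ^~ x @ \oo --> ((altsum 1 (st m x) - limit_altsum x) ^+ 2)%:E.
  apply: cvg_EFin; first exact: nearW.
  rewrite /f /comp /=.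
  have h : altsum 1 (st (n + m) x) @[n --> \oo] --> limit_altsum x.
    by have := hx; rewrite -(cvg_shiftn m).
  have h2 : altsum 1 (st m x) - altsum 1 (st (n + m) x) @[n --> \oo] -->
      altsum 1 (st m x) - limit_altsum x by apply: cvgB => //; exact: cvg_cst.
  exact: (cvgM h2 h2).
by rewrite (cvg_limn_einf_sup cvgf).1.
Qed.

End Limit.
Arguments limit_altsum {R d T} g x.

(** * Moments of the limit and convergence in mean square *)

Section LimitMoments.
Variables (R : realType) (d : measure_display) (T : measurableType d).
Variables (P : probability T R) (g : nat -> T -> bool) (p : R).
Hypotheses (hp0 : 0 <= p) (hp1 : p < 1).
Hypothesis hgmeas : forall n, measurable [set x | g n x].
Hypothesis hlaw : forall s : seq bool,
  P [set x | steps g (size s) x = s] = (erw_prob p s)%:E.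
Local Notation q := (2 * p - 1).
Local Notation st := (steps g).
Local Notation Z := (@limit_altsum R d T g).

Let S n (x : T) : R := altsum 1 (st n x).

Let integrable_S n : P.-integrable setT (EFin \o S n).
Proof. exact: (integrable_steps hgmeas hlaw n (altsum 1)). Qed.

Let integrable_S2 n : P.-integrable setT (EFin \o (fun x => S n x ^+ 2)).
Proof. exact: (integrable_steps hgmeas hlaw n (fun s => altsum 1 s ^+ 2)). Qed.

Let measurable_S n : measurable_fun setT (S n).
Proof. exact: measurable_fun_steps. Qed.

Let measurable_Z : measurable_fun setT (Z : T -> R).
Proof. exact: measurable_limit_altsum hgmeas hlaw. Qed.

Let cst_int (c : R) : P.-integrable setT (EFin \o (fun=> c)).
Proof. exact: finite_measure_integrable_cst. Qed.

Let iD (f h : T -> R) : P.-integrable setT (EFin \o f) -> P.-integrable setT (EFin \o h) ->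
  P.-integrable setT (EFin \o (fun x => f x + h x)).
Proof. by move=> i1 i2; exact: (integrableD measurableT i1 i2). Qed.

Let iZ (c : R) (f : T -> R) : P.-integrable setT (EFin \o f) ->
  P.-integrable setT (EFin \o (fun x => c * f x)).
Proof. by move=> i; exact: (integrableZl measurableT c i). Qed.

Let iabs (f : T -> R) : P.-integrable setT (EFin \o f) ->
  P.-integrable setT (EFin \o (fun x => `|f x|)).
Proof. by move=> i; exact: (integrable_abse i). Qed.

(** One index at finite distance from the limit suffices for square integrability, by
    [Z^2 <= 2 (S - Z)^2 + 2 S^2]. *)
Let N0 : {n0 : nat | (sqr_dist P g n0 <= 1%:E)%E}.
Proof.
apply: cid; have [m0 _ h] := sqr_dist_le hp0 hp1 hgmeas hlaw (@ltr01 R).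
by exists m0; exact: h.
Qed.

Let integrable_le (f h : T -> R) : measurable_fun setT f ->
  P.-integrable setT (EFin \o h) -> (forall x, `|f x| <= h x) ->
  P.-integrable setT (EFin \o f).
Proof.
move=> mf ih fh; apply: le_integrable ih => //; first exact/measurable_EFinP.
by move=> x _ /=; rewrite lee_fin (le_trans (fh x))// ler_norm.
Qed.

Let integrable_d0 : P.-integrable setT (EFin \o (fun x => (S (sval N0) x - Z x) ^+ 2)).
Proof.
apply/integrableP; split.
  by apply/measurable_EFinP; apply: measurable_funX; exact: measurable_funB.
rewrite (eq_integral (fun x => ((S (sval N0) x - Z x) ^+ 2)%:E)); last first.
  by move=> x _; rewrite gee0_abs// lee_fin sqr_ge0.
exact: le_lt_trans (svalP N0) (ltry _).
Qed.

Lemma integrable_limit_sqr : P.-integrable setT (EFin \o (fun x => Z x ^+ 2)).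
Proof.
pose h x : R := 2 * (S (sval N0) x - Z x) ^+ 2 + 2 * S (sval N0) x ^+ 2.
have ih : P.-integrable setT (EFin \o h).
  by apply: iD; apply: iZ.
apply: (integrable_le _ ih); first exact: measurable_funX.
move=> x; rewrite ger0_norm ?sqr_ge0// /h -subr_ge0.
set a := S _ x; set b := Z x.
have -> : 2 * (a - b) ^+ 2 + 2 * a ^+ 2 - b ^+ 2 = (2 * a - b) ^+ 2 by ring.
exact: sqr_ge0.
Qed.

Lemma integrable_limit : P.-integrable setT (EFin \o (Z : T -> R)).
Proof.
have ih : P.-integrable setT (EFin \o (fun x => 1 + Z x ^+ 2)).
  exact: (iD (cst_int 1) integrable_limit_sqr).
apply: (integrable_le measurable_Z ih) => x.
rewrite -[X in 1 + X]real_normK ?num_real//; have := sqr_ge0 (`|Z x| - 1 / 2).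
by have := sqr_ge0 (`|Z x|); nra.
Qed.

Lemma integrable_sqr_dist n : P.-integrable setT (EFin \o (fun x => (S n x - Z x) ^+ 2)).
Proof.
have ih : P.-integrable setT (EFin \o (fun x => 2 * S n x ^+ 2 + 2 * Z x ^+ 2)).
  exact: (iD (iZ 2 (integrable_S2 n)) (iZ 2 integrable_limit_sqr)).
apply: (integrable_le _ ih).
  by apply: measurable_funX; exact: measurable_funB.
move=> x; rewrite ger0_norm ?sqr_ge0// -subr_ge0.
have -> : 2 * S n x ^+ 2 + 2 * Z x ^+ 2 - (S n x - Z x) ^+ 2 = (S n x + Z x) ^+ 2 by ring.
exact: sqr_ge0.
Qed.

Definition mean_sqr_dist n : R := \int[P]_x (S n x - Z x) ^+ 2.

Lemma cvg_mean_sqr_dist : mean_sqr_dist n @[n --> \oo] --> 0.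
Proof.
apply/cvgrPdist_le => e e0.
have [m0 _ h] := sqr_dist_le hp0 hp1 hgmeas hlaw e0.
near=> n; rewrite sub0r normrN ger0_norm; last by apply: Rintegral_ge0 => x _; rewrite sqr_ge0.
rewrite -lee_fin /mean_sqr_dist /Rintegral fineK; last first.
  exact: (integrable_fin_num measurableT (integrable_sqr_dist n)).
by apply: h; near: n; exact: nbhs_infty_ge.
Unshelve. all: by end_near. Qed.

Lemma Rintegral_limit : \int[P]_x Z x = 0.
Proof.
apply/eqP; rewrite -normr_le0; apply/ler_addgt0Pr => e e0; rewrite add0r.
(* A mean square distance of at most [e^2] gives a mean distance of at most [e], through
   [a <= a^2 / (2e) + e / 2]. *)
have e2 : 0 < e ^+ 2 by rewrite exprn_gt0.
have /cvgrPdist_le /(_ _ e2) [m _ hm] := cvg_mean_sqr_dist.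
have := hm m (leqnn m); rewrite /= sub0r normrN => hm1.
have hmm : mean_sqr_dist m <= e ^+ 2 by exact: le_trans (ler_norm _) hm1.
have iB : P.-integrable setT (EFin \o (fun x => S m x - Z x)).
  exact: (integrableB measurableT (integrable_S m) integrable_limit).
have -> : \int[P]_x Z x = - \int[P]_x (S m x - Z x).
  rewrite RintegralB//; last exact: integrable_limit.
  by rewrite (Rintegral_steps hgmeas hlaw m (altsum 1)) Ex_altsum sub0r opprK.
rewrite normrN; apply: le_trans (le_normr_Rintegral _ iB) _ => //.
apply: (@le_trans _ _ (\int[P]_x ((2 * e)^-1 * (S m x - Z x) ^+ 2 + e / 2))).
  apply: le_Rintegral => //.
  - exact: iabs.
  - exact: (iD (iZ (2 * e)^-1 (integrable_sqr_dist m)) (cst_int (e / 2))).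
  move=> x _; rewrite -(real_normK (num_real (S m x - Z x))) -subr_ge0.
  set a := `|_|; have -> : (2 * e)^-1 * a ^+ 2 + e / 2 - a = (2 * e)^-1 * (a - e) ^+ 2.
    by field; rewrite gt_eqF.
  by rewrite mulr_ge0 ?sqr_ge0// invr_ge0 mulr_ge0// ltW.
rewrite (RintegralD measurableT (iZ (2 * e)^-1 (integrable_sqr_dist m)) (cst_int (e / 2))).
rewrite (RintegralZl _ measurableT (integrable_sqr_dist m)) Rintegral_cst//.
rewrite [fine _](_ : _ = 1) ?mulr1 -/(mean_sqr_dist m); last first.
  exact: (congr1 fine (probability_setT P)).
apply: (@le_trans _ _ ((2 * e)^-1 * e ^+ 2 + e / 2)).
  by rewrite lerD2r ler_wpM2l// invr_ge0 mulr_ge0// ltW.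
by rewrite le_eqVlt; apply/orP; left; apply/eqP; field; rewrite gt_eqF.
Qed.

(** The bound [|b^2 - a^2| <= (1 + 1/e) (a - b)^2 + e a^2] is used first with [n] to infinity, which
    removes the distance term, and then with [e] to 0. *)
Lemma Rintegral_limit_sqr (L : R) :
  Ex p n (fun s => altsum 1 s ^+ 2) @[n --> \oo] --> L -> \int[P]_x Z x ^+ 2 = L.
Proof.
set A := \int[P]_x Z x ^+ 2 => cL.
have bound (e : R) n : 0 < e -> `|A - Ex p n (fun s => altsum 1 s ^+ 2)| <=
    (1 + e^-1) * mean_sqr_dist n + e * Ex p n (fun s => altsum 1 s ^+ 2).
  move=> e0.
  have i1 := iZ (1 + e^-1) (integrable_sqr_dist n).
  have i2 := iZ e (integrable_S2 n).
  have -> : Ex p n (fun s => altsum 1 s ^+ 2) = \int[P]_x S n x ^+ 2.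
    by rewrite -(Rintegral_steps hgmeas hlaw n (fun s => altsum 1 s ^+ 2)).
  rewrite -(RintegralB measurableT integrable_limit_sqr (integrable_S2 n)).
  rewrite -(RintegralZl _ measurableT (integrable_sqr_dist n)).
  rewrite -(RintegralZl _ measurableT (integrable_S2 n)) -(RintegralD measurableT i1 i2).
  have iB : P.-integrable setT (EFin \o (fun x => Z x ^+ 2 - S n x ^+ 2)).
    exact: (integrableB measurableT integrable_limit_sqr (integrable_S2 n)).
  apply: le_trans (le_normr_Rintegral _ iB) _ => //.
  apply: le_Rintegral => //.
  - exact: iabs.
  - exact: (iD i1 i2).
  move=> x _; set a := S n x; set b := Z x.
  rewrite ler_norml; apply/andP; split; rewrite -subr_ge0.
    have -> : b ^+ 2 - a ^+ 2 - - ((1 + e^-1) * (a - b) ^+ 2 + e * a ^+ 2) =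
      e^-1 * ((a - b) - e * a) ^+ 2 + 2 * (a - b) ^+ 2 by field; rewrite gt_eqF.
    apply: addr_ge0; last by rewrite mulr_ge0 ?sqr_ge0.
    by rewrite mulr_ge0 ?sqr_ge0// invr_ge0 ltW.
  have -> : (1 + e^-1) * (a - b) ^+ 2 + e * a ^+ 2 - (b ^+ 2 - a ^+ 2) =
    e^-1 * ((a - b) + e * a) ^+ 2 by field; rewrite gt_eqF.
  by rewrite mulr_ge0 ?sqr_ge0// invr_ge0 ltW.
have L0 : 0 <= L.
  rewrite -(cvg_lim _ cL)//; apply: limr_ge; first by apply/cvg_ex; exists L.
  by apply: nearW => n; apply: Ex_ge0 => // s _; rewrite sqr_ge0.
have lim_bound (e : R) : 0 < e -> `|A - L| <= e * L.
  move=> e0.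
  have c1 : `|A - Ex p n (fun s => altsum 1 s ^+ 2)| @[n --> \oo] --> `|A - L|.
    by apply: cvg_norm; apply: cvgB => //; exact: cvg_cst.
  have c2 : (1 + e^-1) * mean_sqr_dist n + e * Ex p n (fun s => altsum 1 s ^+ 2)
      @[n --> \oo] --> (1 + e^-1) * 0 + e * L.
    by apply: cvgD; apply: cvgMr => //; exact: cvg_mean_sqr_dist.
  rewrite -(cvg_lim _ c1)// -[e * L]add0r -[X in X + _](mulr0 (1 + e^-1)) -(cvg_lim _ c2)//.
  apply: ler_lim; [by apply/cvg_ex; eexists; exact: c1|by apply/cvg_ex; eexists; exact: c2|].
  by apply: nearW => n; exact: bound.
apply/eqP; rewrite -subr_eq0 -normr_le0; apply/ler_addgt0Pr => e e0; rewrite add0r.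
have L1 : 0 < L + 1 by rewrite ltr_wpDl.
apply: (le_trans (lim_bound (e / (L + 1)) _)); first by rewrite divr_gt0.
by rewrite mulrAC ler_pdivrMr// ler_wpM2l ?(ltW e0)// lerDl.
Qed.

End LimitMoments.

(** * The martingale part *)

Section MartingalePart.
Variables (R : realType) (p : R).
Hypotheses (hp0 : 0 <= p) (hp1 : p < 1).
Local Notation q := (2 * p - 1).
Implicit Types (s : seq bool) (b : bool).

Definition mart s : R := location s - q * altsum 1 s.

Lemma mart_rcons s b : mart (rcons s b) =
  mart s + (-1) ^+ size s * (sgb b - q * walk s / (size s)%:R).
Proof.
rewrite /mart location_rcons; have [s0|s0] := posnP (size s).
  (* At time 0 the sum gains no term, and the drift is 0 as the inverse of 0 is 0. *)
  by rewrite !altsum_size ?size_rcons ?s0// invr0 !mulr0 !subr0.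
by rewrite altsum_rcons//; ring.
Qed.

Lemma step_mart s : step_prob p s true * mart (rcons s true) +
  step_prob p s false * mart (rcons s false) = mart s.
Proof.
rewrite !step_probE !mart_rcons /sgb.
by move: (q * walk s / _) (_ ^+ size s) (mart s) => m e x; field.
Qed.

(** A variable with values 1 and -1 and mean [m] has variance [1 - m^2]; the alternating sign
    disappears on squaring. *)
Lemma step_mart_sqr s :
  step_prob p s true * (mart (rcons s true) - mart s) ^+ 2 +
  step_prob p s false * (mart (rcons s false) - mart s) ^+ 2 =
  1 - (q * (walk s / (size s)%:R)) ^+ 2.
Proof.
have -> : q * (walk s / (size s)%:R) = q * walk s / (size s)%:R by rewrite mulrA.
rewrite !step_probE !mart_rcons /sgb.
have : ((-1) ^+ size s) ^+ 2 = 1 :> R by rewrite -exprM mulnC exprM sqrrN !expr1n.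
move: (q * walk s / _) (_ ^+ size s) (mart s) => m e x ee.
transitivity (e ^+ 2 * (1 - m ^+ 2)); first by field.
by rewrite ee mul1r.
Qed.

Lemma mart_increment s b : `|mart (rcons s b) - mart s| <= 2.
Proof.
rewrite mart_rcons addrAC subrr add0r normrM normrX normrN1 expr1n mul1r.
rewrite (le_trans (ler_normB _ _))// (_ : 2 = 1 + 1 :> R)// lerD ?norm_drift_le1//.
by case: b; rewrite /sgb ?normrN normr1.
Qed.

Lemma Ex_mart n : Ex p n mart = 0.
Proof.
transitivity (Ex p n location + (- q) * Ex p n (altsum 1)).
  by rewrite -ExZ -ExD; apply: eq_Ex => s _; rewrite mulNr.
by rewrite Ex_location Ex_altsum mulr0 addr0.
Qed.

End MartingalePart.

Lemma altsum_stepsE (R : realType) (T : Type) (g : nat -> T -> bool) n x :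
  altsum 1 (steps g n x) = \sum_(1 <= k < n) (-1) ^+ k * Wn g k x / k%:R :> R.
Proof.
rewrite /altsum /steps size_map size_iota; apply: eq_big_nat => k /andP[_ kn].
by rewrite -map_take take_iota (minn_idPl (ltnW kn)).
Qed.

(** * Martingale property and predictable quadratic variation *)

Section QuadraticVariation.
Variables (R : realType) (d : measure_display) (T : measurableType d).
Variables (P : probability T R) (g : nat -> T -> bool) (p : R).
Hypotheses (hp0 : 0 <= p) (hp1 : p < 1).
Hypothesis hgmeas : forall n, measurable [set x | g n x].
Hypothesis hlaw : forall s : seq bool,
  P [set x | steps g (size s) x = s] = (erw_prob p s)%:E.
Local Notation q := (2 * p - 1).
Local Notation st := (steps g).
Local Notation Xi := (fun n x => mart p (st n x)).

Lemma ae_martingale n : {ae P, forall x, cexp P g n (Xi n.+1) x = Xi n x}.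
Proof.
apply: filterS (erw_prob_steps_neq0 hgmeas hlaw) => x /(_ n) e0.
by rewrite (cexp_steps hgmeas hlaw (mart p) e0) step_mart.
Qed.

Lemma predQVE n x : (forall k, erw_prob p (st k x) != 0) ->
  predQV P g Xi n x = \sum_(0 <= k < n) (1 - (q * (walk (st k x) / k%:R)) ^+ 2).
Proof.
move=> e0; rewrite /predQV big_add1 /=; apply: eq_big_nat => k _.
(* Truncating the longer word with [take k] expresses the increment as a function of that word
   alone. *)
have := cexp_steps hgmeas hlaw (fun t => (mart p t - mart p (take k t)) ^+ 2) (e0 k).
have -> : (fun y => (mart p (st k.+1 y) - mart p (take k (st k.+1 y))) ^+ 2) =
    (fun y => (mart p (st k.+1 y) - mart p (st k y)) ^+ 2).
  by apply/funext => y; rewrite take_steps.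
move=> ->; have := step_mart_sqr p (st k x); rewrite size_steps => <-.
by rewrite -!cats1 !take_size_cat ?size_steps.
Qed.

(** By [predQVE] the quotient is a Cesaro mean of [1 - (q W_k / k)^2], and [W_k / k] tends to 0. *)
Lemma ae_cvg_predQV : {ae P, forall x,
  (fun n => predQV P g Xi n x / n%:R) @ \oo --> (1 : R)}.
Proof.
have e0 := erw_prob_steps_neq0 hgmeas hlaw.
have cW := ae_cvg hp0 hp1 hgmeas hlaw.
apply: filterS2 e0 cW => x ex [cx _].
pose u k : R := 1 - (q * (walk (st k x) / k%:R)) ^+ 2.
have cu : u @ \oo --> (1 : R).
  have h1 : q * (walk (st n x) / n%:R) @[n --> \oo] --> q * 0 by exact: cvgMr cx.
  rewrite mulr0 in h1.
  have h2 := cvgB (cvg_cst (1 : R)) (cvgM h1 h1); rewrite mulr0 subr0 in h2.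
  exact: h2.
have := cesaro cu; rewrite -[X in _ -> X]cvg_shiftS /=.
suff -> : arithmetic_mean u = (fun n => predQV P g Xi n.+1 x / n.+1%:R) by [].
by apply/funext => n; rewrite predQVE// mulrC.
Qed.

End QuadraticVariation.

(** * Assembly of the decomposition and of its limit *)

Theorem theorem2p2 (R : realType) (d : measure_display) (T : measurableType d)
  (P : probability T R) (g : nat -> T -> bool) (p : R)
  (hp0 : 0 <= p) (hp1 : p < 1)
  (hgmeas : forall n, measurable [set x | g n x])
  (hlaw : forall s : seq bool,
     P [set x | steps g (size s) x = s] = (erw_prob p s)%:E) :
  let q := 2 * p - 1 in
  exists Xi : nat -> T -> R,
    (forall n, Fmeas g n (Xi n)) /\
    (forall n, Rintegral P setT (Xi n) = 0) /\
    (exists C : R, forall n x, `|Xi n.+1 x - Xi n x| <= C) /\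
    (forall n, {ae P, forall x, cexp P g n (Xi n.+1) x = Xi n x}) /\
    {ae P, forall x, (fun n => predQV P g Xi n x / n%:R) @ \oo --> (1 : R)} /\
    (forall n x, Delta_s g n x =
        Xi n x + q * \sum_(1 <= k < n) (-1) ^+ k * Wn g k x / k%:R) /\
    (forall n, Fmeas g n (fun x => Delta_s g n.+1 x - Xi n.+1 x)) /\
    exists Zinf : T -> R,
      measurable_fun setT Zinf /\
      P.-integrable setT (EFin \o Zinf) /\
      P.-integrable setT (EFin \o (fun x => Zinf x ^+ 2)) /\
      {ae P, forall x, (fun n => Delta_s g n x - Xi n x) @ \oo --> Zinf x} /\
      (fun n => Rintegral P setT
          (fun x => (Delta_s g n x - Xi n x - Zinf x) ^+ 2)) @ \oo --> (0 : R) /\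
      Rintegral P setT Zinf = 0 /\
      Rintegral P setT (fun x => Zinf x ^+ 2) =
        (if q != 1 / 2 then
           q ^+ 2 / (2 * q - 1) *
           Rintegral (@lebesgue_measure R) `[0, 1]
             (fun u => (u `^ (- 2 * q + 1) - 1) / (1 - u) *
                       (((1 - u / 2) `^ (q - 1) - 1) / u))
         else
           1 / 4 *
           Rintegral (@lebesgue_measure R) `[0, 1]
             (fun u => (- ln u) / (1 - u) *
                       (((1 - u / 2) `^ (- (1 / 2)) - 1) / u))).
Proof.
move=> q; exists (fun n x => mart p (steps g n x)).
have DE n x : Delta_s g n x - mart p (steps g n x) = q * altsum 1 (steps g n x).
  by rewrite /mart /Delta_s -/(signed_length _ _) opprB addrC subrK.
have Delta_sE n x : Delta_s g n x = location (steps g n x) :> R by [].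
split; first by move=> n; exists (mart p).
split; first by move=> n; rewrite (Rintegral_steps hgmeas hlaw) Ex_mart.
split; first by exists 2 => n x; rewrite stepsS mart_increment.
split; first by move=> n; exact: ae_martingale.
split; first exact: ae_cvg_predQV.
split.
  by move=> n x; rewrite -altsum_stepsE -DE addrC subrK.
split.
  (* Predictability: at time [n + 1] the sum stops at [k = n] and reads only the first [n] steps. *)
  move=> n; exists (fun s => q * \sum_(1 <= k < n.+1) (-1) ^+ k * walk (take k s) / k%:R) => x.
  rewrite DE; congr (_ * _); rewrite /altsum size_steps.
  by apply: eq_big_nat => k /andP[_ kn]; rewrite !take_steps// ltnW.
have iZ := integrable_limit hp0 hp1 hgmeas hlaw.
have iZ2 := integrable_limit_sqr hp0 hp1 hgmeas hlaw.
exists (fun x => q * limit_altsum g x); split.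
  by apply: measurable_funM => //; exact: measurable_limit_altsum hgmeas hlaw.
split; first exact: (integrableZl measurableT q iZ).
have sqrE : (fun x => (q * limit_altsum g x) ^+ 2) = (fun x => q ^+ 2 * limit_altsum g x ^+ 2).
  by apply/funext => x; rewrite exprMn.
split; first by rewrite sqrE; exact: (integrableZl measurableT (q ^+ 2) iZ2).
split.
  apply: filterS (ae_cvg_limit_altsum hp0 hp1 hgmeas hlaw) => x hx.
  have -> : (fun n => Delta_s g n x - mart p (steps g n x)) = (fun n => q * altsum 1 (steps g n x)).
    by apply/funext => n; exact: DE.
  exact: cvgMr hx.
split.
  have h := cvgMr (a := q ^+ 2) (cvg_mean_sqr_dist hp0 hp1 hgmeas hlaw); rewrite mulr0 in h.
  rewrite [X in X @ \oo --> _](_ : _ = (fun n => q ^+ 2 * mean_sqr_dist P g n)); first exact: h.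
  apply/funext => n; rewrite /mean_sqr_dist.
  rewrite -(RintegralZl (q ^+ 2) measurableT (integrable_sqr_dist hp0 hp1 hgmeas hlaw n)).
  by apply: eq_Rintegral => x _; rewrite DE -mulrBr exprMn.
split; first by rewrite RintegralZl// (Rintegral_limit hp0 hp1 hgmeas hlaw) mulr0.
rewrite sqrE RintegralZl//; case: ifPn => q2.
  rewrite (Rintegral_limit_sqr hp0 hp1 hgmeas hlaw (cvg_Ex_altsum_neq hp0 hp1 q2)).
  by rewrite mulrA.
move: q2; rewrite negbK => /eqP q2.
(* Here [q = 1/2], so the prefactor [q^2] is the stated 1/4. *)
rewrite (Rintegral_limit_sqr hp0 hp1 hgmeas hlaw (cvg_Ex_altsum_eq hp0 hp1 q2)) q2.
by congr (_ * _); lra.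
Qed.
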